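(* There is an absolute constant $c>0$ such that for every integer $n>1$ there exists a triangulation $G$ with $n$ vertices, having two vertices $s$ and $t$, such that the expected number of steps taken by the \textsc{Random-Compass} algorithm when routing from $s$ to $t$ in $G$ is at least $2^{cn}$, i.e., the expected number of steps is $2^{\Omega(n)}$.
   Context: A geometric graph is a graph whose vertices are points in $\mathbb{R}^2$ and whose edges are straight line segments. A triangulation is a plane geometric graph all of whose faces, except the outer face, are triangles, and whose outer face is the complement of a triangle. The \textsc{Random-Compass} routing algorithm routes a packet toward the target vertex $t$ as follows. While the packet is at a vertex $v\neq t$, let $\mathrm{cw}_t(v)$ be the neighbour $w$ of $v$ for which the clockwise angle from the ray $vt$ to the segment $vw$ is smallest. Let $\mathrm{ccw}_t(v)$ be the neighbour $w$ of $v$ for which the counterclockwise angle from the ray $vt$ to the segment $vw$ is smallest. The algorithm tosses a fair coin, independently at each step, and moves the packet to one of these (at most two) neighbours, each chosen with probability $1/2$. Each move along an edge counts as one step. The routing terminates when the packet reaches $t$.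
   Formalization: ''For every integer n>1'' is replaced by ''for all sufficiently large n'': no triangulation has 2 vertices, and with 3 or 4 vertices all pairs are adjacent, so routing takes at most one step, less than 2^{cn}. *)

(* Defs.v *)
From HB Require Import structures.
From mathcomp Require Import all_boot all_order all_algebra.
From mathcomp Require Import all_classical all_reals all_analysis.
Set Implicit Arguments. Unset Strict Implicit. Unset Printing Implicit Defensive.
Import Order.TTheory GRing.Theory Num.Theory.
Import numFieldNormedType.Exports.
Local Open Scope ring_scope.
Local Open Scope classical_set_scope.

Section Geometry.
Variable R : realType.
Implicit Types p q a b c z : (R * R)%type.

Definition seg p q : set (R * R) :=
  [set z | exists2 l : R, 0 <= l <= 1 &
     z = ((1 - l) * p.1 + l * q.1, (1 - l) * p.2 + l * q.2)].

Definition vsub p q : R * R := (p.1 - q.1, p.2 - q.2).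
Definition cross p q : R := p.1 * q.2 - p.2 * q.1.
Definition dot p q : R := p.1 * q.1 + p.2 * q.2.
Definition vnorm p : R := Num.sqrt (p.1 ^+ 2 + p.2 ^+ 2).

Definition collinear a b c : Prop := cross (vsub b a) (vsub c a) = 0.

Definition closed_triangle a b c : set (R * R) :=
  [set z | exists l1 l2 l3 : R, [/\ 0 <= l1, 0 <= l2, 0 <= l3, l1 + l2 + l3 = 1 &
     z = (l1 * a.1 + l2 * b.1 + l3 * c.1, l1 * a.2 + l2 * b.2 + l3 * c.2)]].

Definition open_triangle a b c : set (R * R) :=
  [set z | exists l1 l2 l3 : R, [/\ 0 < l1, 0 < l2, 0 < l3, l1 + l2 + l3 = 1 &
     z = (l1 * a.1 + l2 * b.1 + l3 * c.1, l1 * a.2 + l2 * b.2 + l3 * c.2)]].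

(* counterclockwise angle in [0, 2pi) from direction d to direction e
   (both nonzero) *)
Definition ccw_angle (d e : R * R) : R :=
  let co := dot d e / (vnorm d * vnorm e) in
  if 0 <= cross d e then acos co else 2 * pi - acos co.

Definition cw_angle (d e : R * R) : R := ccw_angle e d.

End Geometry.

Section GeometricGraph.
Variables (R : realType) (n : nat).
Variables (pos : 'I_n -> (R * R)%type) (adj : rel 'I_n).

Definition is_geometric_graph : Prop :=
  [/\ injective pos, irreflexive adj & symmetric adj].

Definition is_plane : Prop :=
  [/\ is_geometric_graph,
      (forall u v w, adj u v -> seg (pos u) (pos v) (pos w) -> w = u \/ w = v) &
      (forall u v x y z, adj u v -> adj x y ->
          ~ ([set u; v] = [set x; y] :> set 'I_n) ->
          seg (pos u) (pos v) z -> seg (pos x) (pos y) z ->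
          exists2 w, (w = u \/ w = v) /\ (w = x \/ w = y) & z = pos w)].

Definition drawing : set (R * R) :=
  range pos `|` \bigcup_(uv in [set uv : 'I_n * 'I_n | adj uv.1 uv.2])
                   seg (pos uv.1) (pos uv.2).

Definition face_of (z : R * R) : set (R * R) :=
  connected_component (~` drawing) z.

Definition is_triangulation : Prop :=
  is_plane /\
  (forall z, ~ drawing z ->
     exists a b c : R * R, ~ collinear a b c /\
       (face_of z = open_triangle a b c \/ face_of z = ~` closed_triangle a b c)).

Definition cw_t (t v w : 'I_n) : bool :=
  adj v w && [forall w' : 'I_n, adj v w' ==>
    (cw_angle (vsub (pos t) (pos v)) (vsub (pos w) (pos v))
       <= cw_angle (vsub (pos t) (pos v)) (vsub (pos w') (pos v)))].

Definition ccw_t (t v w : 'I_n) : bool :=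
  adj v w && [forall w' : 'I_n, adj v w' ==>
    (ccw_angle (vsub (pos t) (pos v)) (vsub (pos w) (pos v))
       <= ccw_angle (vsub (pos t) (pos v)) (vsub (pos w') (pos v)))].

Definition rc_step (t v w : 'I_n) : R :=
  (cw_t t v w)%:R / 2 + (ccw_t t v w)%:R / 2.

(* surv s t k v = probability that the walk from s is at v after k steps and
   has not visited t during steps 0..k *)
Fixpoint surv (s t : 'I_n) (k : nat) (w : 'I_n) : R :=
  match k with
  | 0 => ((w == s) && (w != t))%:R
  | k'.+1 => if w == t then 0
             else \sum_(v : 'I_n | v != t) surv s t k' v * rc_step t v w
  end.

(* expected number of steps = sum_{k >= 0} P(T > k) (possibly +oo) *)
Definition expected_steps (s t : 'I_n) : \bar R :=
  (\sum_(k <oo) (\sum_(v : 'I_n) surv s t k v)%:E)%E.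

End GeometricGraph.

(* Main.v *)
(* Around the target, the hub, sit three inner vertices [m1], [m2], [m3] and
   three outer vertices [u1], [u2], [u3], twisted like a pinwheel: the ray from
   [ui] to the hub leaves through the edge [mi u(i+1)].  Each edge [ui mi] is
   subdivided by the points [w_j = ui + 2^-j (mi - ui)], all joined to
   [u(i+1)] and to [m(i-1)].  From [w_(j+1)] the packet moves to [w_j] or is
   thrown back to [u(i+1)], and from [ui] it moves to the first subdivision
   point or to [u(i+1)]; so the hub is reached only after a run of about k
   lucky tosses.  Quantitatively, the function equal to [1] at [ui], to
   [1 - 2^-j] at [w_j] and to [0] elsewhere loses at most a factor [1 - 2^-k]
   in mean at every step, hence the walk survives [i] steps with probability at
   least [1 - i 2^-k].

   The subdivided pinwheel is built by local surgeries (adding a vertex inside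
   a face, flipping an edge, adding a vertex on an edge).  A triangle whose
   sides are drawn and whose interior is not is automatically a face, being
   open and relatively closed in the complement of the drawing. *)
Require Import Defs.
From HB Require Import structures.
From mathcomp Require Import all_boot all_order all_algebra.
From mathcomp Require Import all_classical all_reals all_analysis.
From mathcomp Require Import zify ring lra.
Set Implicit Arguments. Unset Strict Implicit. Unset Printing Implicit Defensive.
Import Order.TTheory GRing.Theory Num.Theory.
Import numFieldNormedType.Exports.
Local Open Scope ring_scope.
Local Open Scope classical_set_scope.

(** * Orientation, segments and triangles *)

(** Faces are connected components and routing compares values of [acos]; both are brought down to
    signs of [orient], twice a signed area, kept locked so that simplification does not expand it
    into coordinates. Vertices and edges remain a list and a relation on points until the graph is
    complete, so that a surgery renumbers nothing. The potential is fitted to the coin: (1 + (1 -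
    2^-j)) / 2 = 1 - 2^-(j+1), so at the subdivision points its mean is preserved exactly, and only
    a toss at some [ui] loses anything. Being thrown back to [u(i+1)] restores the full value 1. The
    three arms feed one another cyclically, so the walk leaves the trap only through some [mi],
    where the potential is 0. Three arms let the [ui] form the outer triangle. *)

HB.lock Definition orient (R : realType) (a b c : R * R) : R :=
  cross (vsub b a) (vsub c a).

Section Orientation.
Variable R : realType.
Notation pt := (R * R)%type.
Implicit Types a b c d p x y z : pt.

Lemma orientE a b c : orient a b c =
  (b.1 - a.1) * (c.2 - a.2) - (b.2 - a.2) * (c.1 - a.1).
Proof. by rewrite unlock. Qed.

Lemma orient_rot a b c : orient b c a = orient a b c.
Proof. by rewrite !orientE /=; ring. Qed.

Lemma orient_rotr a b c : orient c a b = orient a b c.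
Proof. by rewrite -orient_rot. Qed.

Lemma orient_swap a b c : orient b a c = - orient a b c.
Proof. by rewrite !orientE /=; ring. Qed.

Lemma orient_sum a b c z :
  orient a b z + orient b c z + orient c a z = orient a b c.
Proof. by rewrite !orientE /=; ring. Qed.

Lemma orientxx a b : (orient a a b = 0) * (orient a b a = 0) * (orient a b b = 0).
Proof. by rewrite !orientE /=; do !split; ring. Qed.

Definition comb2 (l : R) a b : pt :=
  ((1 - l) * a.1 + l * b.1, (1 - l) * a.2 + l * b.2).

Definition comb3 (l1 l2 l3 : R) a b c : pt :=
  (l1 * a.1 + l2 * b.1 + l3 * c.1, l1 * a.2 + l2 * b.2 + l3 * c.2).

Lemma orient_comb2 x y l a b :
  orient x y (comb2 l a b) = (1 - l) * orient x y a + l * orient x y b.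
Proof. by rewrite !orientE /=; ring. Qed.

Lemma orient_comb3 x y l1 l2 l3 a b c : l1 + l2 + l3 = 1 ->
  orient x y (comb3 l1 l2 l3 a b c) =
  l1 * orient x y a + l2 * orient x y b + l3 * orient x y c.
Proof.
move=> h; have -> : l1 = 1 - l2 - l3 by rewrite -h; ring.
by rewrite !orientE /=; ring.
Qed.

(** Cramer's rule: barycentric coordinates are ratios of signed areas. *)
Lemma comb3_orient a b c z : orient a b c != 0 ->
  z = comb3 (orient b c z / orient a b c) (orient c a z / orient a b c)
            (orient a b z / orient a b c) a b c.
Proof.
case: a => a1 a2; case: b => b1 b2; case: c => c1 c2; case: z => z1 z2.
by rewrite /comb3 !orientE /= => h; congr pair; field; rewrite h.
Qed.

Lemma open_triangleP a b c z : 0 < orient a b c ->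
  open_triangle a b c z <->
  [/\ 0 < orient a b z, 0 < orient b c z & 0 < orient c a z].
Proof.
move=> h; split=> [[l1 [l2 [l3 [h1 h2 h3 hs ->]]]]|[h1 h2 h3]].
  rewrite -/(comb3 l1 l2 l3 a b c) !orient_comb3// !orientxx !mulr0 !(addr0, add0r).
  rewrite (orient_rot a b c) (orient_rotr a b c); split; apply: mulr_gt0 => //.
rewrite /open_triangle /mkset; exists (orient b c z / orient a b c); exists (orient c a z / orient a b c).
exists (orient a b z / orient a b c); split; rewrite ?divr_gt0//.
  by rewrite -!mulrDl -(orient_sum a b c z) addrC addrA divff// orient_sum gt_eqF.
by apply: comb3_orient; rewrite gt_eqF.
Qed.

Lemma closed_triangleP a b c z : 0 < orient a b c ->
  closed_triangle a b c z <->
  [/\ 0 <= orient a b z, 0 <= orient b c z & 0 <= orient c a z].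
Proof.
move=> h; split=> [[l1 [l2 [l3 [h1 h2 h3 hs ->]]]]|[h1 h2 h3]].
  rewrite -/(comb3 l1 l2 l3 a b c) !orient_comb3// !orientxx !mulr0 !(addr0, add0r).
  rewrite (orient_rot a b c) (orient_rotr a b c); split; apply: mulr_ge0 => //; exact: ltW.
rewrite /closed_triangle /mkset; exists (orient b c z / orient a b c); exists (orient c a z / orient a b c).
exists (orient a b z / orient a b c); split; rewrite ?divr_ge0// ?ltW//.
  by rewrite -!mulrDl -(orient_sum a b c z) addrC addrA divff// orient_sum gt_eqF.
by apply: comb3_orient; rewrite gt_eqF.
Qed.

Lemma segl a b : seg a b a.
Proof.
by exists 0; [lra|case: a => a1 a2; rewrite /=; congr pair; ring].
Qed.

Lemma segC a b z : seg a b z -> seg b a z.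
Proof.
move=> [l hl ->]; exists (1 - l); first by lra.
by congr pair; ring.
Qed.

Lemma segr a b : seg a b b.
Proof. by apply: segC; apply: segl. Qed.

Lemma segE a b z : seg a b z -> exists2 l, 0 <= l <= 1 & z = comb2 l a b.
Proof. by move=> [l hl ->]; exists l. Qed.

Lemma comb2_id a b : (comb2 0 a b = a) * (comb2 1 a b = b).
Proof.
by case: a => a1 a2; case: b => b1 b2; split; rewrite /comb2 /=; congr pair; ring.
Qed.

Lemma seg_edge a b c z : 0 < orient a b c -> orient a b z = 0 ->
  0 <= orient b c z -> 0 <= orient c a z -> seg a b z.
Proof.
move=> h h0 h1 h2; have h3 := orient_sum a b c z.
have hn : orient a b c != 0 by rewrite gt_eqF.
exists (orient c a z / orient a b c).
  apply/andP; split; first by apply: divr_ge0 => //; apply: ltW.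
  by rewrite ler_pdivrMr// mul1r; lra.
have e : orient b c z / orient a b c = 1 - orient c a z / orient a b c.
  by apply: (mulIf hn); rewrite mulrBl !divfK// mul1r; lra.
by rewrite {1}(comb3_orient z hn) /comb3 h0 !mul0r !addr0 e.
Qed.

Lemma seg_closed a b c x y z : 0 < orient a b c ->
  closed_triangle a b c x -> closed_triangle a b c y -> seg x y z ->
  closed_triangle a b c z.
Proof.
move=> h /closed_triangleP-/(_ h) [x1 x2 x3] /closed_triangleP-/(_ h) [y1 y2 y3].
move=> /segE[l /andP[l0 l1] ->]; apply/closed_triangleP => //; rewrite !orient_comb2.
have l2 : 0 <= 1 - l by lra.
by split; apply: addr_ge0; apply: mulr_ge0.
Qed.

Lemma open_closed a b c z : open_triangle a b c z -> closed_triangle a b c z.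
Proof.
by move=> [l1 [l2 [l3 [h1 h2 h3 hs ->]]]]; exists l1, l2, l3; split=> //; exact: ltW.
Qed.

Lemma closed_vertices a b c : 0 < orient a b c ->
  [/\ closed_triangle a b c a, closed_triangle a b c b & closed_triangle a b c c].
Proof.
by move=> h; split; apply/closed_triangleP; rewrite ?orientxx
  ?(orient_rot a b c) ?(orient_rotr a b c) //; split=> //; apply: ltW.
Qed.

Lemma closed_boundary a b c z : 0 < orient a b c -> closed_triangle a b c z ->
  [\/ open_triangle a b c z, seg a b z, seg b c z | seg c a z].
Proof.
move=> h /closed_triangleP-/(_ h) [h1 h2 h3].
have [e1|n1] := eqVneq (orient a b z) 0; first by apply: Or42; apply: (seg_edge h).
have [e2|n2] := eqVneq (orient b c z) 0.
  by apply: Or43; apply: (@seg_edge _ _ a); rewrite ?(orient_rot a b c).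
have [e3|n3] := eqVneq (orient c a z) 0.
  by apply: Or44; apply: (@seg_edge _ _ b); rewrite ?(orient_rotr a b c).
by apply: Or41; apply/open_triangleP => //; rewrite !lt_def n1 n2 n3 h1 h2 h3.
Qed.

Lemma open_triangle_rot a b c : open_triangle b c a `<=` open_triangle a b c.
Proof.
move=> _ [l1 [l2 [l3 [h1 h2 h3 hs ->]]]]; exists l3, l1, l2; split=> //.
  by rewrite -hs; ring.
by congr pair; ring.
Qed.

Lemma continuous_orient a b : continuous (orient a b).
Proof.
have -> : orient a b = fun z : pt =>
    (b.1 - a.1) * (z.2 - a.2) - (b.2 - a.2) * (z.1 - a.1).
  by apply/funext => z; rewrite orientE.
move=> z; apply: cvgB; apply: cvgM; do ?exact: cvg_cst.
  by apply: cvgB; [exact: cvg_snd|exact: cvg_cst].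
by apply: cvgB; [exact: cvg_fst|exact: cvg_cst].
Qed.

Lemma open_halfplane a b : open [set z | 0 < orient a b z].
Proof.
have := @open_comp _ _ (orient a b) [set r | 0 < r] (fun z _ => @continuous_orient a b z).
by move=> /(_ (@open_gt _ _)).
Qed.

Lemma open_open_triangle a b c : 0 < orient a b c -> open (open_triangle a b c).
Proof.
move=> h; have -> : open_triangle a b c = [set z | 0 < orient a b z] `&`
   [set z | 0 < orient b c z] `&` [set z | 0 < orient c a z].
  apply/seteqP; split=> z => [/open_triangleP-/(_ h) []//|[[? ?] ?]].
  exact/open_triangleP.
by do ?apply: openI; apply: open_halfplane.
Qed.

Lemma setC_closed_triangle a b c : 0 < orient a b c ->
  ~` closed_triangle a b c = [set z | 0 < orient b a z] `|`
   [set z | 0 < orient c b z] `|` [set z | 0 < orient a c z].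
Proof.
move=> h; apply/seteqP; split=> z; rewrite /setC /setU /= closed_triangleP//.
  move=> hz; have [h1|h1] := ltP 0 (orient b a z); first by left; left.
  have [h2|h2] := ltP 0 (orient c b z); first by left; right.
  have [h3|h3] := ltP 0 (orient a c z); first by right.
  by exfalso; apply: hz; rewrite (orient_swap b a) (orient_swap c b) (orient_swap a c); split; lra.
rewrite (orient_swap a b) (orient_swap b c) (orient_swap c a) => -[[]|] h1 [] *; lra.
Qed.

Lemma open_setC_closed_triangle a b c : 0 < orient a b c ->
  open (~` closed_triangle a b c).
Proof.
move=> h; rewrite setC_closed_triangle//.
by do ?apply: openU; apply: open_halfplane.
Qed.

Lemma continuous_comb2 a b : continuous (fun l : R => comb2 l a b).
Proof.
move=> l; have h (r s : R) : (fun l : R => (1 - l) * r + l * s) @ l --> (1 - l) * r + l * s.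
  apply: cvgD; apply: cvgM; do ?[exact: cvg_cst|exact: cvg_id].
  by apply: cvgB; [exact: cvg_cst|exact: cvg_id].
exact: cvg_pair (h a.1 b.1) (h a.2 b.2).
Qed.

(** Moving [z] slightly towards the centroid makes all three orientations positive. In [surgery]
    this protects the sides of old faces: every neighbourhood of a boundary point meets the open
    triangle. *)
Lemma closed_triangle_closure a b c : 0 < orient a b c ->
  closed_triangle a b c `<=` closure (open_triangle a b c).
Proof.
move=> h z /closed_triangleP-/(_ h) [h1 h2 h3] B Bz.
pose g := comb3 (1/3) (1/3) (1/3) a b c.
have e1 : 1/3 + 1/3 + 1/3 = 1 :> R by lra.
have cv : comb2 e z g @[e --> 0^'+] --> z.
  apply: cvg_at_right_filter; rewrite -[X in _ --> X](comb2_id z g).1.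
  exact: continuous_comb2.
have hB := cv _ Bz; near (0 : R)^'+ => e.
have Be : B (comb2 e z g) by near: e.
have e0 : 0 < e by near: e; exact: nbhs_right_gt.
have e2 : e <= 1 by near: e; exact: nbhs_right_le.
exists (comb2 e z g); split=> //.
apply/open_triangleP => //; rewrite !orient_comb2 !orient_comb3// !orientxx.
rewrite (orient_rot a b c) (orient_rotr a b c).
have e3 : 0 <= 1 - e by lra.
have hg (r : R) : r = orient a b c -> 0 < e * (1 / 3 * r) by move=> ->; rewrite !mulr_gt0//; lra.
by split; apply: ltr_wpDl; rewrite ?mulr_ge0// !mulr0 ?addr0 ?add0r; apply: hg.
Unshelve. all: end_near. Qed.

Lemma convex_connected (A : set pt) :
  (forall x y, A x -> A y -> seg x y `<=` A) -> connected A.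
Proof.
move=> hA; have [->|/set0P[x Ax]] := eqVneq A set0; first exact: connected0.
have -> : A = \bigcup_(y in A) seg x y.
  apply/seteqP; split=> [y Ay|z [y Ay hz]]; last exact: (hA x y).
  by exists y => //; apply: segr.
apply: bigcup_connected; first by exists x => y _; apply: segl.
move=> y _; have -> : seg x y = (fun l : R => comb2 l x y) @` `[0, 1].
  apply/seteqP; split=> [z [l hl ->]|z [l hl <-]].
    by exists l => //; rewrite set_itvE.
  by exists l => //; move: hl; rewrite set_itvE.
apply: connected_continuous_connected; first exact: segment_connected.
exact/continuous_subspaceT/continuous_comb2.
Qed.

Lemma connected_halfplane a b : connected [set z | 0 < orient a b z].
Proof.
apply: convex_connected => x y /= hx hy z /segE[l hl ->] /=.
rewrite orient_comb2; have [->|l0] := eqVneq l 0; first by lra.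
have l1 : 0 < l by rewrite lt_def l0; case/andP: hl.
have l2 : 0 <= 1 - l by lra.
by apply: ltr_wpDl; [apply: mulr_ge0 => //; apply: ltW|apply: mulr_gt0].
Qed.

Lemma connected_open_triangle a b c : 0 < orient a b c ->
  connected (open_triangle a b c).
Proof.
move=> h; apply: convex_connected => x y.
move=> /open_triangleP-/(_ h) [x1 x2 x3] /open_triangleP-/(_ h) [y1 y2 y3].
move=> z /segE[l hl ->]; apply/open_triangleP => //; rewrite !orient_comb2.
have hp (r s : R) : 0 < r -> 0 < s -> 0 < (1 - l) * r + l * s.
  move=> hr hs; have [->|l0] := eqVneq l 0; first by lra.
  have l1 : 0 < l by rewrite lt_def l0; case/andP: hl.
  have l2 : 0 <= 1 - l by lra.
  by apply: ltr_wpDl; [apply: mulr_ge0 => //; apply: ltW|apply: mulr_gt0].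
by split; apply: hp.
Qed.

(** The set is a union of three open half-planes, one beyond each side; each is convex, and two of
    them overlap beyond their common vertex. *)
Lemma connected_setC_closed_triangle a b c : 0 < orient a b c ->
  connected (~` closed_triangle a b c).
Proof.
move=> h; rewrite setC_closed_triangle//.
have h' : 0 < orient b c a by rewrite (orient_rot a b c).
have h'' : 0 < orient c a b by rewrite (orient_rotr a b c).
apply: connectedU; last exact: connected_halfplane.
(* The point 3a - b - c lies beyond the vertex [a], on the outer side of both sides through it; 3b -
   a - c does the same at [b] below. *)
- exists (comb3 3 (-1) (-1) a b c); split; last by
    rewrite /= orient_comb3 ?orientxx ?(orient_swap c a); lra.
  by left; rewrite /= orient_comb3 ?orientxx ?(orient_swap a b); lra.
- apply: connectedU; try exact: connected_halfplane.
  exists (comb3 (-1) 3 (-1) a b c); split;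
    rewrite /= orient_comb3 ?orientxx ?(orient_swap a b) ?(orient_swap b c); lra.
Qed.

End Orientation.

(** * Faces of a drawing and local surgery *)

Section Faces.
Variable R : realType.
Notation pt := (R * R)%type.
Implicit Types (a b c d p x y z : pt) (D U W Q : set pt).

(** [W] witnesses that [U] is relatively closed. It is left free so that one lemma serves the
    bounded faces and the outer face, with the roles of the two open sets exchanged. *)
Lemma component_clopen D U W z : open U -> open W -> connected U -> U z ->
  U `<=` ~` D -> ~` D `<=` U `|` W -> (forall x, U x -> W x -> False) ->
  connected_component (~` D) z = U.
Proof.
move=> oU oW cU Uz UD DUW UW; apply/seteqP; split; last exact: connected_component_max.
set C := connected_component _ _.
have Cz : C z by apply: connected_component_refl; apply: UD.
have CD : C `<=` ~` D by exact: connected_component_sub.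
have <- : C `&` U = C; last by move=> x [].
apply: (component_connected (A := ~` D) (x := z)); first by exists z.
  by exists U.
exists (~` W); first by rewrite closedC.
apply/seteqP; split=> x [Cx h]; split=> //; first by move=> /(UW x h).
by case: (DUW _ (CD _ Cx)) => // /h.
Qed.

(** Corners are listed counterclockwise, so the two faces at an edge traverse it in opposite
    directions, as [split_edge] and [flip_edge] expect. *)
Definition face D a b c : Prop :=
  [/\ 0 < orient a b c, (forall z, open_triangle a b c z -> ~ D z),
      seg a b `<=` D, seg b c `<=` D & seg c a `<=` D].

Lemma face_rot D a b c : face D a b c -> face D b c a.
Proof.
move=> [h hD ab bc ca]; split=> //; first by rewrite (orient_rot a b c).
by move=> z /open_triangle_rot; apply: hD.
Qed.

Lemma face_component D a b c z : face D a b c -> open_triangle a b c z ->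
  connected_component (~` D) z = open_triangle a b c.
Proof.
move=> [h hD ab bc ca] hz.
apply: (component_clopen (W := ~` closed_triangle a b c)) => //.
- exact: open_open_triangle.
- exact: open_setC_closed_triangle.
- exact: connected_open_triangle.
- move=> x nDx; have [cx|] := pselect (closed_triangle a b c x); last by right.
  by case: (closed_boundary h cx); [left|move=> /ab|move=> /bc|move=> /ca].
- by move=> x /open_closed hx; apply.
Qed.

(** Both triangles are the component of the common point. *)
Lemma face_eq D a b c a' b' c' z : face D a b c -> face D a' b' c' ->
  open_triangle a b c z -> open_triangle a' b' c' z ->
  open_triangle a b c = open_triangle a' b' c'.
Proof.
by move=> f f' hz hz'; rewrite -(face_component f hz) -(face_component f' hz').
Qed.

Definition drawn (V : seq pt) (E : pt -> pt -> Prop) : set pt :=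
  [set z | z \in V \/ exists x y, E x y /\ seg x y z].

Definition ends x y z := z = x \/ z = y.

Definition same_edge x y x' y' := (x = x' /\ y = y') \/ (x = y' /\ y = x').

(** Invariant carried through the surgeries. [tri_cov] concerns only the inside of the outer
    triangle; since its sides stay drawn and all vertices stay within it, its complement is a face
    at the end. *)
Record triangulated A B C (V : seq pt) (E : pt -> pt -> Prop) : Prop := {
  tri_uniq : uniq V;
  tri_outer : 0 < orient A B C;
  tri_AB : E A B; tri_BC : E B C; tri_CA : E C A;
  tri_sym : forall x y, E x y -> E y x;
  tri_irr : forall x y, E x y -> x <> y;
  tri_mem : forall x y, E x y -> x \in V;
  tri_in : forall x, x \in V -> closed_triangle A B C x;
  tri_vtx : forall x y w, E x y -> w \in V -> seg x y w -> ends x y w;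
  tri_cross : forall x y x' y' z, E x y -> E x' y' -> seg x y z -> seg x' y' z ->
     same_edge x y x' y' \/ (ends x y z /\ ends x' y' z);
  tri_cov : forall z, closed_triangle A B C z -> ~ drawn V E z ->
     exists a b c, face (drawn V E) a b c /\ open_triangle a b c z }.

(* [E0] is what remains of the edges [E], [P] and [F] are the new vertices and
   edges, [Q] is the region in which everything happens, and [G] lists the new
   faces.  Deleted edges must be redrawn or lie in the interior of [Q], so that
   they bound no face outside [Q]. *)
Lemma surgery A B C (V P : seq pt) (E E0 F : pt -> pt -> Prop) Q
    (G : pt -> pt -> pt -> Prop) :
  let D := drawn V E in let E' := fun x y => E0 x y \/ F x y in
  let D' := drawn (P ++ V) E' in
  triangulated A B C V E ->
  (forall x y, E0 x y -> E x y) -> (forall x y, E0 x y -> E0 y x) ->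
  [/\ E0 A B, E0 B C & E0 C A] ->
  uniq (P ++ V) ->
  (forall p, p \in P -> closed_triangle A B C p /\ Q p) ->
  (forall x y, F x y -> [/\ F y x, x <> y & x \in P ++ V]) ->
  (forall z, Q z -> ~ drawn V E0 z) ->
  (forall x y z, F x y -> seg x y z -> Q z \/ (ends x y z /\ z \in V)) ->
  (forall x y p, F x y -> p \in P -> seg x y p -> ends x y p) ->
  (forall x y x' y' z, F x y -> F x' y' -> seg x y z -> seg x' y' z ->
     same_edge x y x' y' \/ (ends x y z /\ ends x' y' z)) ->
  (forall z, Q z -> D z \/
     exists a b c, [/\ face D a b c, open_triangle a b c z & open_triangle a b c `<=` Q]) ->
  (forall z, D z -> D' z \/ interior Q z) ->
  (forall a b c, G a b c -> [/\ 0 < orient a b c, open_triangle a b c `<=` Q,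
     (forall z, open_triangle a b c z -> z \notin P /\ forall x y, F x y -> ~ seg x y z) &
     [/\ seg a b `<=` D', seg b c `<=` D' & seg c a `<=` D']]) ->
  (forall z, Q z -> D' z \/ exists a b c, G a b c /\ open_triangle a b c z) ->
  [/\ triangulated A B C (P ++ V) E',
      forall a b c, G a b c -> face D' a b c &
      forall a b c, face D a b c -> (forall z, open_triangle a b c z -> ~ Q z) ->
        face D' a b c].
Proof.
move=> D E' D' T E0E E0s [E0AB E0BC E0CA] uPV hP hF hQ hFQ hPF hFF hQE hrem hG hcov.
have hD' z : D' z -> [\/ drawn V E0 z, z \in P | exists x y, F x y /\ seg x y z].
  case; first by rewrite mem_cat => /orP[?|?]; [apply: Or32|apply: Or31; left].
  move=> [x [y [[h|h] hz]]]; last by apply: Or33; exists x, y.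
  by apply: Or31; right; exists x, y.
have E0D x y z : E0 x y -> seg x y z -> drawn V E0 z by right; exists x, y.
have D0D z : drawn V E0 z -> D z.
  by case=> [|[x [y [h hz]]]]; [left|right; exists x, y; split=> //; apply: E0E].
have newface a b c : G a b c -> face D' a b c.
  move=> /hG[h hGQ hGF [? ? ?]]; split=> // z hz /hD'[].
  - by apply: hQ; apply: hGQ.
  - by apply/negP; case: (hGF z hz).
  - by move=> [x [y [/((hGF z hz).2 _ _)]]].
have oldface a b c : face D a b c -> (forall z, open_triangle a b c z -> ~ Q z) ->
    face D' a b c.
  move=> [h hD ab bc ca] hn.
  (* The interior of [Q] is open: containing a point of the closed triangle, it would meet the open
     one. Hence no side of an old face is lost with a deleted edge. *)
  have cl z : closed_triangle a b c z -> ~ interior Q z.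
    move=> /(closed_triangle_closure h) hz iQ.
    by have [w [hw /(hn _ hw)]] := hz _ iQ.
  have bnd x y : closed_triangle a b c x -> closed_triangle a b c y ->
      seg x y `<=` D -> seg x y `<=` D'.
    move=> hx hy hxy z hz; case: (hrem _ (hxy _ hz)) => // iQ; exfalso.
    by apply: (cl z) iQ; apply: seg_closed hz.
  have [ha hb hc] := closed_vertices h.
  split; rewrite //; try exact: bnd.
  move=> z hz /hD'[hz'|hz'|[x [y [Fxy hz']]]].
  - by apply: (hD z) => //; apply: D0D.
  - by apply: (hn z) => //; case: (hP z hz').
  - case: (hFQ _ _ _ Fxy hz'); first exact: hn.
    by move=> [_ zV]; apply: (hD z) => //; left.
have [tu to tAB tBC tCA ts ti tm tin tv tc tcov] := T.
have PVin x : x \in P ++ V -> closed_triangle A B C x.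
  by rewrite mem_cat => /orP[/hP[]//|/tin].
split=> //; split=> //.
- by left.
- by left.
- by left.
- by move=> x y [/E0s|/hF[]]; [left|right].
- by move=> x y [/E0E/ti|/hF[]].
- by move=> x y [/E0E/tm|/hF[]//]; rewrite mem_cat orbC => ->.
- move=> x y w [h|h]; rewrite mem_cat => /orP[wP|wV] hw.
  + by have [_ /hQ[]] := hP w wP; apply: E0D hw.
  + by apply: (tv x y) => //; apply: E0E.
  + exact: (hPF x y).
  + by case: (hFQ _ _ _ h hw) => [/hQ[]|[]//]; left.
- have mixed x y x' y' z : E0 x y -> F x' y' -> seg x y z -> seg x' y' z ->
      ends x y z /\ ends x' y' z.
    move=> h h' hz hz'; case: (hFQ _ _ _ h' hz') => [/hQ[]|[he zV]].
      exact: E0D hz.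
    by split=> //; apply: (tv x y) => //; apply: E0E.
  move=> x y x' y' z [h|h] [h'|h'] hz hz'.
  + by apply: tc hz hz'; apply: E0E.
  + by right; apply: mixed h h' hz hz'.
  + by right; have [? ?] := mixed _ _ _ _ _ h' h hz' hz.
  + exact: hFF hz hz'.
- move=> z hz nz.
  have hQz : Q z -> exists a b c, face D' a b c /\ open_triangle a b c z.
    by move=> /hcov[/nz//|[a [b [c [/newface]]]]]; exists a, b, c.
  have [Dz|nDz] := pselect (D z).
    by case: (hrem z Dz) => [/nz//|/interior_subset/hQz].
  have [a [b [c [fD oz]]]] := tcov z hz nDz.
  have [hq|hq] := pselect (exists2 w, open_triangle a b c w & Q w); last first.
    exists a, b, c; split=> //; apply: oldface => // w hw Qw; apply: hq.
    by exists w.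
  have [w hw Qw] := hq; apply: hQz.
  (* [w] lies in a face contained in [Q]; sharing [w], it is the face around [z], so [z] is in [Q]
     too and the new faces cover it. *)
  case: (hQE w Qw) => [Dw|[a' [b' [c' [f' hw' sub]]]]].
    by case: fD => _ /(_ w hw).
  by apply: sub; rewrite (face_eq f' fD hw' hw).
Qed.
End Faces.

(** * Inserting a vertex inside a face *)

Section Surgeries.
Variable R : realType.
Notation pt := (R * R)%type.
Implicit Types (a b c d p q x y z : pt) (D U W Q : set pt).

(** Multiplicativity of the determinant: the right-hand side is the 3 x 3 determinant of the
    unnormalized barycentric coordinates of [x], [y], [w] with respect to [a b c]. *)
Lemma orient_product a b c x y w :
  orient a b c ^+ 2 * orient x y w =
  orient b c x * (orient c a y * orient a b w - orient a b y * orient c a w)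
  - orient c a x * (orient b c y * orient a b w - orient a b y * orient b c w)
  + orient a b x * (orient b c y * orient c a w - orient c a y * orient b c w).
Proof. by rewrite !orientE; ring. Qed.

(** Were an orientation zero at a point of the inner triangle, all three corners would lie on that
    side of [a b c]; a column of the determinant in [orient_product] would vanish and [x y w] would
    be flat. *)
Lemma open_sub a b c x y w : 0 < orient a b c -> 0 < orient x y w ->
  closed_triangle a b c x -> closed_triangle a b c y -> closed_triangle a b c w ->
  open_triangle x y w `<=` open_triangle a b c.
Proof.
move=> h h' /closed_triangleP-/(_ h) [x1 x2 x3] /closed_triangleP-/(_ h) [y1 y2 y3].
move=> /closed_triangleP-/(_ h) [w1 w2 w3] _ [l1 [l2 [l3 [h1 h2 h3 hs ->]]]].
have hK : 0 < orient a b c ^+ 2 * orient x y w by rewrite mulr_gt0// exprn_gt0.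
rewrite orient_product in hK.
have pos (r s t : R) : 0 <= r -> 0 <= s -> 0 <= t -> ~ [/\ r = 0, s = 0 & t = 0] ->
    0 < l1 * r + l2 * s + l3 * t.
  move=> r0 s0 t0 hn; rewrite lt_def !addr_ge0 ?mulr_ge0 ?(ltW h1) ?(ltW h2) ?(ltW h3)//.
  rewrite andbT; apply/eqP => e; apply: hn.
  have [a1 a2 a3] : [/\ 0 <= l1 * r, 0 <= l2 * s & 0 <= l3 * t].
    by split; apply: mulr_ge0 => //; apply: ltW.
  have z1 : l1 * r = 0 by lra.
  have z2 : l2 * s = 0 by lra.
  have z3 : l3 * t = 0 by lra.
  split; [move/eqP: z1|move/eqP: z2|move/eqP: z3];
    by rewrite mulf_eq0 gt_eqF//= => /eqP.
apply/open_triangleP => //; rewrite -/(comb3 l1 l2 l3 x y w) !orient_comb3//.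
by split; apply: pos => // -[e1 e2 e3]; move: hK; rewrite e1 e2 e3;
  rewrite !(mul0r, mulr0, subr0, subrr, addr0, ltxx).
Qed.

Lemma seg_open_end a b c p x z : 0 < orient a b c -> open_triangle a b c p ->
  closed_triangle a b c x -> seg p x z -> open_triangle a b c z \/ z = x.
Proof.
move=> h /open_triangleP-/(_ h) [p1 p2 p3] /closed_triangleP-/(_ h) [x1 x2 x3].
move=> /segE[l /andP[l0 l1] ->]; have [->|nl] := eqVneq l 1.
  by right; rewrite comb2_id.
have l2 : 0 < 1 - l by rewrite subr_gt0 lt_def eq_sym nl.
left; apply/open_triangleP => //; rewrite !orient_comb2.
by split; apply: ltr_pwDl; rewrite ?mulr_gt0 ?mulr_ge0.
Qed.

(** The line through [q] and [p] separates [x] from [y], and the segment [p x] touches it only at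
    [p]. *)
Lemma seg_meet_side q p x y z : orient q p x < 0 -> 0 <= orient q p y ->
  seg p x z -> seg p y z -> z = p.
Proof.
move=> hx hy /segE[l /andP[l0 l1] ->] /segE[l' /andP[l0' l1'] e].
have := congr1 (orient q p) e; rewrite !orient_comb2 !orientxx !mulr0 !add0r => e'.
have [->|nl] := eqVneq l 0; first by rewrite comb2_id.
have : l * orient q p x < 0 by rewrite nmulr_llt0// lt_def nl.
by rewrite e' ltNge mulr_ge0.
Qed.

Lemma seg_meet p x y z : 0 < orient x y p -> seg p x z -> seg p y z -> z = p.
Proof.
move=> h hx hy; apply: (@seg_meet_side x p y x) => //; last by rewrite orientxx.
by rewrite orient_swap (orient_rotr x y p) oppr_lt0.
Qed.

Definition star p (N : seq pt) x y := (x = p /\ y \in N) \/ (y = p /\ x \in N).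

Definition add_star (E0 : pt -> pt -> Prop) p N x y := E0 x y \/ star p N x y.

(** Common frame of the two insertions, inside a face and on an edge. All new edges leave [p] and
    meet pairwise only there, which settles the planarity conditions of [surgery]. *)
Lemma star_surgery A B C (V : seq pt) (E E0 : pt -> pt -> Prop) p N Q
    (G : pt -> pt -> pt -> Prop) :
  let D := drawn V E in let E' := add_star E0 p N in
  let D' := drawn (p :: V) E' in
  triangulated A B C V E ->
  (forall x y, E0 x y -> E x y) -> (forall x y, E0 x y -> E0 y x) ->
  [/\ E0 A B, E0 B C & E0 C A] ->
  closed_triangle A B C p -> Q p ->
  (0 < size N)%N ->
  (forall x, x \in N -> x \in V) ->
  (forall z, Q z -> ~ drawn V E0 z) ->
  (forall x z, x \in N -> seg p x z -> Q z \/ z = x) ->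
  (forall x y z, x \in N -> y \in N -> x <> y -> seg p x z -> seg p y z -> z = p) ->
  (forall z, Q z -> D z \/
     exists a b c, [/\ face D a b c, open_triangle a b c z & open_triangle a b c `<=` Q]) ->
  (forall z, D z -> D' z) ->
  (forall a b c, G a b c -> [/\ 0 < orient a b c, open_triangle a b c `<=` Q,
     (forall z, open_triangle a b c z -> forall x, x \in N -> ~ seg p x z) &
     [/\ seg a b `<=` D', seg b c `<=` D' & seg c a `<=` D']]) ->
  (forall z, Q z -> D' z \/ exists a b c, G a b c /\ open_triangle a b c z) ->
  [/\ triangulated A B C (p :: V) E',
      forall a b c, G a b c -> face D' a b c &
      forall a b c, face D a b c -> (forall z, open_triangle a b c z -> ~ Q z) ->
        face D' a b c].
Proof.
move=> D E' D' T E0E E0s E0o clp Qp N0 NV hQ hN hNN hQE hD hG hcov.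
have pV : p \notin V by apply/negP => pV; apply: (hQ p Qp); left.
have pN x : x \in N -> p <> x by move=> /NV xV e; rewrite e xV in pV.
have starP x y : star p N x y ->
    exists2 w, w \in N & same_edge x y p w.
  by move=> [[-> h]|[-> h]]; [exists y|exists x] => //; [left|right].
have segs x y w z : same_edge x y p w -> seg x y z -> seg p w z.
  by move=> [[-> ->]|[-> ->]] // /segC.
have endsP x y w z : same_edge x y p w -> ends p w z -> ends x y z.
  by move=> [[-> ->]|[-> ->]] // []; [right|left].
apply: (surgery (P := [:: p]) T (E0 := E0) (F := star p N) (Q := Q) (G := G)) => //.
- by rewrite /= pV; case: T.
- by move=> x; rewrite inE => /eqP ->.
- move=> x y [[-> h]|[-> h]]; split; rewrite ?inE ?eqxx//.
  + by right.
  + exact: pN.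
  + by left.
  + by move=> e; apply: (pN x).
  + by rewrite NV// orbT.
- move=> x y z /starP[w wN e] /(segs _ _ _ _ e) /(hN _ _ wN) [|->]; first by left.
  by right; split; [apply: endsP e _; right|apply: NV].
- move=> x y q /starP[w wN e]; rewrite inE => /eqP -> _.
  by apply: endsP e _; left.
- move=> x y x' y' z /starP[w wN e] /starP[w' wN' e'].
  move=> /(segs _ _ _ _ e) h /(segs _ _ _ _ e') h'.
  have [eq|ne] := eqVneq w w'; last first.
    right; have -> : z = p by apply: (hNN w w') => //; apply/eqP.
    by split; [apply: endsP e _|apply: endsP e' _]; left.
  left; rewrite -eq in e'; move: e e'.
  by move=> [[-> ->]|[-> ->]] [[-> ->]|[-> ->]]; [left|right|right|left].
- by move=> z /hD; left.
- move=> a b c /hG[h1 h2 h3 h4]; split=> // z hz; split.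
    rewrite inE; apply/eqP => e; have [x xN] : exists x, x \in N.
      by case: (N) N0 => // x s _; exists x; rewrite mem_head.
    by apply: (h3 z hz x xN); rewrite e; apply: segl.
  by move=> x y /starP[w wN e] /(segs _ _ _ _ e); apply: h3.
Qed.

Lemma open_triangle_star a b c p z : 0 < orient a b c -> open_triangle a b c p ->
  open_triangle a b c z ->
  (exists2 x, x \in [:: a; b; c] & seg p x z) \/
  [\/ open_triangle p a b z, open_triangle p b c z | open_triangle p c a z].
Proof.
move=> h /open_triangleP-/(_ h) [p1 p2 p3] /open_triangleP-/(_ h) [z1 z2 z3].
(* The coefficients are proportional to the barycentric coordinates of [p], so the sum is
   proportional to [orient p p z], which is zero: the three orientations cannot share a strict
   sign. *)
have e : orient b c p * orient p a z + orient c a p * orient p b z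
    + orient a b p * orient p c z = 0 by rewrite !orientE; ring.
have ab : 0 < orient p a b by rewrite (orient_rotr a b p).
have bc : 0 < orient p b c by rewrite (orient_rotr b c p).
have ca : 0 < orient p c a by rewrite (orient_rotr c a p).
have flip x : orient x p z = - orient p x z by rewrite orient_swap.
have [sa|sa|sa] := ltgtP (orient p a z) 0; last first.
- have [sb|sb] := ltP 0 (orient p b z).
    right; apply: Or32; apply/open_triangleP => //; split=> //; rewrite flip oppr_gt0.
    by rewrite sa mulr0 add0r in e; rewrite -(pmulr_rlt0 _ p1); nra.
  left; exists a; first by rewrite !inE eqxx.
  by apply: (seg_edge ab) => //; [exact: ltW|rewrite flip oppr_ge0].
- have [sb|sb] := ltP (orient p b z) 0.
    by right; apply: Or31; apply/open_triangleP => //; split=> //; rewrite flip oppr_gt0.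
  have sc : orient p c z < 0 by nra.
  move: sb; rewrite le_eqVlt => /predU1P[sb|sb].
    left; exists b; first by rewrite !inE eqxx orbT.
    by apply: (seg_edge bc) => //; [exact: ltW|rewrite flip oppr_ge0 ltW].
  by right; apply: Or32; apply/open_triangleP => //; split=> //; rewrite flip oppr_gt0.
- have [sc|sc] := ltP 0 (orient p c z).
    by right; apply: Or33; apply/open_triangleP => //; split=> //; rewrite flip oppr_gt0.
  have sb : 0 < orient p b z by nra.
  move: sc; rewrite le_eqVlt => /predU1P[sc|sc].
    left; exists c; first by rewrite !inE eqxx !orbT.
    by apply: (seg_edge ca) => //; [exact: ltW|rewrite flip oppr_ge0 ltW].
  by right; apply: Or32; apply/open_triangleP => //; split=> //; rewrite flip oppr_gt0.
Qed.

Lemma seg_drawn V (E : pt -> pt -> Prop) x y : E x y -> seg x y `<=` drawn V E.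
Proof. by move=> h z hz; right; exists x, y. Qed.

Lemma open_sub_closed a b c x y z A B C : 0 < orient A B C ->
  closed_triangle A B C a -> closed_triangle A B C b -> closed_triangle A B C c ->
  open_triangle a b c z -> closed_triangle A B C z.
Proof.
move=> h /closed_triangleP-/(_ h) [a1 a2 a3] /closed_triangleP-/(_ h) [b1 b2 b3].
move=> /closed_triangleP-/(_ h) [c1 c2 c3] [l1 [l2 [l3 [h1 h2 h3 hs ->]]]].
apply/closed_triangleP => //; rewrite -/(comb3 l1 l2 l3 a b c) !orient_comb3//.
by split; rewrite !addr_ge0// mulr_ge0// ltW.
Qed.

Lemma stack A B C V (E : pt -> pt -> Prop) a b c p :
  let D := drawn V E in
  let E' := add_star E p [:: a; b; c] in
  let D' := drawn (p :: V) E' in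
  triangulated A B C V E -> face D a b c -> {subset [:: a; b; c] <= V} ->
  open_triangle a b c p ->
  [/\ triangulated A B C (p :: V) E',
      [/\ face D' p a b, face D' p b c & face D' p c a] &
      forall x y w, face D x y w ->
        (forall z, open_triangle x y w z -> ~ open_triangle a b c z) -> face D' x y w].
Proof.
move=> D E' D' T fD NV hp; have [h hD ab bc ca] := fD.
pose G x y w := [\/ (x, y, w) = (p, a, b), (x, y, w) = (p, b, c) | (x, y, w) = (p, c, a)].
have [p1 p2 p3] : [/\ 0 < orient a b p, 0 < orient b c p & 0 < orient c a p].
  exact/open_triangleP.
have [cla clb clc] := closed_vertices h.
have clN x : x \in [:: a; b; c] -> closed_triangle a b c x.
  by rewrite !inE => /or3P[] /eqP ->.
have DD' : D `<=` D'.
  move=> z [zV|[x [y [hE hz]]]]; first by left; rewrite inE zV orbT.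
  by right; exists x, y; split=> //; left.
have ED' x : x \in [:: a; b; c] -> seg p x `<=` D'.
  by move=> hx; apply: seg_drawn; right; left.
have ED'' x : x \in [:: a; b; c] -> seg x p `<=` D'.
  by move=> hx; apply: seg_drawn; right; right.
have [T' hG hold] : [/\ triangulated A B C (p :: V) E',
      forall a b c, G a b c -> face D' a b c &
      forall a0 b0 c0, face D a0 b0 c0 ->
        (forall z, open_triangle a0 b0 c0 z -> ~ open_triangle a b c z) ->
        face D' a0 b0 c0].
  apply: (star_surgery (E0 := E) (Q := open_triangle a b c)) => //.
  - by case: T.
  - by case: T.
  - have inV x : x \in [:: a; b; c] -> closed_triangle A B C x.
      by move=> /NV; apply: (tri_in T).
    by apply: open_sub_closed hp; rewrite ?(tri_outer T)//; apply: inV;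
      rewrite !inE eqxx ?orbT.
  - by move=> x z hx; apply: seg_open_end => //; apply: clN.
  - move=> x y z; rewrite !inE => /or3P[] /eqP -> /or3P[] /eqP -> // _ hx hy.
    + exact: (seg_meet p1 hx hy).
    + exact: (seg_meet p3 hy hx).
    + exact: (seg_meet p1 hy hx).
    + exact: (seg_meet p2 hx hy).
    + exact: (seg_meet p3 hx hy).
    + exact: (seg_meet p2 hy hx).
  - by move=> z hz; right; exists a, b, c; split=> // w.
  (* The three new triangles differ by a rotation of [a b c]; [w] is the corner left out, not on the
     side of [p u] where [v] lies. *)
  - have new u v w : 0 < orient u v p -> closed_triangle a b c u ->
        closed_triangle a b c v -> orient p u w <= 0 -> u \in [:: a; b; c] ->
        v \in [:: a; b; c] -> [:: a; b; c] =i [:: u; v; w] -> seg u v `<=` D' ->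
        [/\ 0 < orient p u v, open_triangle p u v `<=` open_triangle a b c,
         (forall z, open_triangle p u v z ->
            forall x, x \in [:: a; b; c] -> ~ seg p x z) &
         [/\ seg p u `<=` D', seg u v `<=` D' & seg v p `<=` D']].
      move=> huv clu clv hw uN vN eN sD'.
      have h' : 0 < orient p u v by rewrite (orient_rotr u v p).
      split=> //; first by apply: open_sub => //; apply: open_closed.
        move=> z /open_triangleP-/(_ h') [z1 z2 z3] x.
        rewrite eN !inE => /or3P[] /eqP -> /segE[l /andP[l0 l1] ez].
        - by move: z1; rewrite ez orient_comb2 !orientxx; lra.
        - by move: z3; rewrite ez orient_comb2 !orientxx; lra.
        - by move: z1; rewrite ez orient_comb2 !orientxx; nra.
      by split=> //; [apply: ED'|apply: ED''].
    move=> x y w [] [-> -> ->].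
    + apply: (new _ _ c) => //; rewrite ?inE ?eqxx ?orbT//.
        by rewrite orient_swap (orient_rot c a p) oppr_le0 ltW.
      by apply: subset_trans ab DD'.
    + apply: (new _ _ a) => //; rewrite ?inE ?eqxx ?orbT//.
      * by rewrite orient_swap (orient_rot a b p) oppr_le0 ltW.
      * by move=> x'; rewrite !inE; do 3 case: eqP.
      * by apply: subset_trans bc DD'.
    + apply: (new _ _ b) => //; rewrite ?inE ?eqxx ?orbT//.
      * by rewrite orient_swap (orient_rot b c p) oppr_le0 ltW.
      * by move=> x'; rewrite !inE; do 3 case: eqP.
      * by apply: subset_trans ca DD'.
  - move=> z /(open_triangle_star h hp) [[x xN hx]|]; first by left; apply: (ED' x).
    by move=> H; right; case: H => H; [exists p, a, b|exists p, b, c|exists p, c, a];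
      split=> //; [apply: Or31|apply: Or32|apply: Or33].
by split=> //; split; apply: hG; [apply: Or31|apply: Or32|apply: Or33].
Qed.

End Surgeries.

(** * Subdividing and flipping an edge *)

Section EdgeSurgeries.
Variable R : realType.
Notation pt := (R * R)%type.
Implicit Types (a b c d p q x y z : pt) (D U W Q : set pt).

Definition open_seg b c : set pt := [set z | exists2 l, 0 < l < 1 & z = comb2 l b c].

Lemma open_seg_seg b c : open_seg b c `<=` seg b c.
Proof. by move=> _ [l hl ->]; exists l => //; lra. Qed.

Lemma open_seg_ends b c z : b <> c -> open_seg b c z -> ~ ends b c z.
Proof.
case: b => b1 b2; case: c => c1 c2 bc [l /andP[l0 l1] ->].
rewrite /ends /comb2 /= => -[] [e1 e2]; apply: bc; congr pair.
- by apply/eqP; rewrite -subr_eq0 -(mulrI_eq0 _ (lregP (lt0r_neq0 l0))); apply/eqP; lra.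
- by apply/eqP; rewrite -subr_eq0 -(mulrI_eq0 _ (lregP (lt0r_neq0 l0))); apply/eqP; lra.
- have l2 : 0 < 1 - l by lra.
  by apply/eqP; rewrite -subr_eq0 -(mulrI_eq0 _ (lregP (lt0r_neq0 l2))); apply/eqP; lra.
- have l2 : 0 < 1 - l by lra.
  by apply/eqP; rewrite -subr_eq0 -(mulrI_eq0 _ (lregP (lt0r_neq0 l2))); apply/eqP; lra.
Qed.

Lemma seg_cases b c z : seg b c z -> ends b c z \/ open_seg b c z.
Proof.
move=> /segE[l /andP[l0 l1] ->].
have [->|n0] := eqVneq l 0; first by left; left; rewrite comb2_id.
have [->|n1] := eqVneq l 1; first by left; right; rewrite comb2_id.
by right; exists l => //; rewrite !lt_def n0 l0 eq_sym n1 l1.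
Qed.

Lemma open_segC b c : open_seg b c `<=` open_seg c b.
Proof.
by move=> _ [l hl ->]; exists (1 - l); [lra|rewrite /comb2; congr pair; ring].
Qed.

Definition del_edge (E : pt -> pt -> Prop) b c x y := E x y /\ ~ same_edge x y b c.

Lemma del_edge_sym (E : pt -> pt -> Prop) b c : (forall x y, E x y -> E y x) ->
  forall x y, del_edge E b c x y -> del_edge E b c y x.
Proof.
move=> h x y [hE ne]; split; first exact: h.
by move=> [[e1 e2]|[e1 e2]]; apply: ne; [right|left].
Qed.

(** Vertices and other edges meet [b c] at its ends only, so deleting the edge frees its interior
    for the surgery region. *)
Lemma del_edge_open_seg A B C V (E : pt -> pt -> Prop) b c z :
  triangulated A B C V E -> E b c -> open_seg b c z ->
  ~ drawn V (del_edge E b c) z.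
Proof.
move=> T bc oz; have ne := open_seg_ends (tri_irr T bc) oz.
have sz := open_seg_seg oz; case=> [zV|[x [y [[hE nse] hz]]]].
  by apply: ne; apply: (tri_vtx T bc).
by case: (tri_cross T hE bc hz sz) => [//|[]].
Qed.

Lemma del_edge_sub V (E : pt -> pt -> Prop) b c :
  drawn V (del_edge E b c) `<=` drawn V E.
Proof. by move=> z [|[x [y [[h _] hz]]]]; [left|right; exists x, y]. Qed.

Lemma open_seg_split b c p z : open_seg b c p -> seg b c z -> seg p b z \/ seg p c z.
Proof.
move=> [s /andP[s0 s1] ->] /segE[l /andP[l0 l1] ->].
have [ls|ls] := leP l s.
  left; exists (1 - l / s).
    by rewrite subr_ge0 ler_pdivrMr// mul1r ls/= gerBl divr_ge0// ltW.
  by rewrite /comb2 /=; congr pair; field; rewrite gt_eqF.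
right; have s2 : 0 < 1 - s by lra.
exists ((l - s) / (1 - s)).
  apply/andP; split; first by rewrite divr_ge0 ?subr_ge0// ltW.
  by rewrite ler_pdivrMr// mul1r; lra.
by rewrite /comb2 /=; congr pair; field; rewrite gt_eqF.
Qed.

Lemma open_seg_half a b c p : 0 < orient b c a -> open_seg b c p ->
  [/\ 0 < orient b p a, 0 < orient p c a & orient b c p = 0].
Proof.
move=> h [s /andP[s0 s1] ->].
have -> : orient b (comb2 s b c) a = s * orient b c a by rewrite !orientE /=; ring.
have -> : orient (comb2 s b c) c a = (1 - s) * orient b c a by rewrite !orientE /=; ring.
by rewrite orient_comb2 !orientxx !mulr0 addr0 !mulr_gt0// subr_gt0.
Qed.

(** One side of an edge subdivision, applied to both sides of [b c] in turn. The segments from [p]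
    to [b], [c] and [d] stay on the far closed side of the line [b c], and [p a] is the common side
    of the two halves. *)
Lemma half_split a b c d p : 0 < orient b c a -> orient b c d < 0 ->
  open_seg b c p ->
  [/\ open_triangle b p a `<=` open_triangle b c a,
      open_triangle p c a `<=` open_triangle b c a,
      (forall z, open_triangle b c a z ->
         [\/ open_triangle b p a z, open_triangle p c a z | seg p a z]) &
      forall z, open_triangle b p a z \/ open_triangle p c a z ->
         forall x, x \in [:: b; c; a; d] -> ~ seg p x z].
Proof.
move=> h hd hp; have [h1 h2 h3] := open_seg_half h hp.
have [clb clc cla] := closed_vertices h.
have clp : closed_triangle b c a p by apply: seg_closed h _ _ (open_seg_seg hp).
have s1 : open_triangle b p a `<=` open_triangle b c a by apply: open_sub.
have s2 : open_triangle p c a `<=` open_triangle b c a by apply: open_sub.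
split=> //.
  move=> z /open_triangleP-/(_ h) [z1 z2 z3].
  have bp : 0 < orient b p z.
    case: hp => s /andP[s0 _] ->.
    have -> : orient b (comb2 s b c) z = s * orient b c z by rewrite !orientE /=; ring.
    by rewrite mulr_gt0.
  have pc : 0 < orient p c z.
    case: hp => s /andP[_ s0] ->.
    have -> : orient (comb2 s b c) c z = (1 - s) * orient b c z.
      by rewrite !orientE /=; ring.
    by rewrite mulr_gt0// subr_gt0.
  have e : orient a p z = - orient p a z by rewrite orient_swap.
  have [pa|pa|pa] := ltgtP (orient p a z) 0.
  - by apply: Or32; apply/open_triangleP => //; split=> //; rewrite e oppr_gt0.
  - by apply: Or31; apply/open_triangleP.
  - apply: Or33; apply: (@seg_edge _ p a b) => //.
    + by rewrite (orient_rot b p a).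
    + exact: ltW.
    + exact: ltW.
move=> z hz x; have [z1 z2 z3] : [/\ 0 < orient b c z, 0 < orient c a z & 0 < orient a b z].
  by apply/(open_triangleP z h); case: hz; [apply: s1|apply: s2].
rewrite !inE => /or4P[] /eqP -> /segE[l /andP[l0 l1] ez].
- by move: z1; rewrite ez orient_comb2 h3 orientxx; lra.
- by move: z1; rewrite ez orient_comb2 h3 orientxx; lra.
- case: hz => [/open_triangleP-/(_ h1) [_ + _]|/open_triangleP-/(_ h2) [_ _ +]];
    by rewrite ez orient_comb2 !orientxx; lra.
- by move: z1; rewrite ez orient_comb2 h3; nra.
Qed.

Definition disjoint_triangles a b c x y w :=
  forall z, open_triangle a b c z -> ~ open_triangle x y w z.

(** The region of the surgery is the two faces at [b c] together with the open edge. The three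
    exclusions keep the sides of the outer triangle among the surviving edges. *)
Lemma split_edge A B C V (E : pt -> pt -> Prop) a b c d p :
  let D := drawn V E in
  let E' := add_star (del_edge E b c) p [:: b; c; a; d] in
  let D' := drawn (p :: V) E' in
  triangulated A B C V E -> face D b c a -> face D c b d -> E b c ->
  ~ same_edge A B b c -> ~ same_edge B C b c -> ~ same_edge C A b c ->
  a \in V -> d \in V -> open_seg b c p ->
  [/\ triangulated A B C (p :: V) E',
      p \notin V,
      [/\ face D' b p a, face D' p c a, face D' c p d & face D' p b d] &
      forall x y w, face D x y w -> disjoint_triangles x y w b c a ->
        disjoint_triangles x y w c b d -> face D' x y w].
Proof.
move=> D E' D' T f0 f1 bc nAB nBC nCA aV dV hp.
have [h0 hD0 sbc sca sab] := f0; have [h1 hD1 scb sbd sdc] := f1.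
have h1' : orient b c d < 0 by rewrite orient_swap oppr_lt0.
have h0' : orient c b a < 0 by rewrite orient_swap oppr_lt0.
have [s01 s02 cov0 off0] := half_split h0 h1' hp.
have [s11 s12 cov1 off1] := half_split h1 h0' (open_segC hp).
have [p1 p2 p3] := open_seg_half h0 hp.
have [p1' p2' p3'] := open_seg_half h1 (open_segC hp).
pose Q := open_triangle b c a `|` open_triangle c b d `|` open_seg b c.
pose G x y w := (x, y, w) = (b, p, a) \/ (x, y, w) = (p, c, a) \/
  (x, y, w) = (c, p, d) \/ (x, y, w) = (p, b, d).
have inV x : x \in [:: b; c; a; d] -> x \in V.
  rewrite !inE => /or4P[] /eqP -> //; first exact: (tri_mem T bc).
  exact: (tri_mem T (tri_sym T bc)).
have pV : p \notin V.
  by apply/negP => pV; apply: (del_edge_open_seg T bc hp); left.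
have sN x : x \in [:: b; c; a; d] -> seg p x `<=` D'.
  by move=> hx; apply: seg_drawn; right; left.
have sN' x : x \in [:: b; c; a; d] -> seg x p `<=` D'.
  by move=> hx; apply: seg_drawn; right; right.
have [bN cN aN dN] : [/\ b \in [:: b; c; a; d], c \in [:: b; c; a; d],
    a \in [:: b; c; a; d] & d \in [:: b; c; a; d]].
  by rewrite !inE !eqxx !orbT.
(* The drawing only grows: the deleted edge reappears as its halves [p b] and [p c]. *)
have DD' : D `<=` D'.
  move=> z [zV|[x [y [hE hz]]]]; first by left; rewrite inE zV orbT.
  have [se|nse] := pselect (same_edge x y b c); last first.
    by right; exists x, y; split=> //; left.
  have hz' : seg b c z by case: se hz => -[-> ->] // /segC.
  by case: (open_seg_split hp hz'); apply: sN.
have [T' hG hold] : [/\ triangulated A B C (p :: V) E',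
      forall x y w, G x y w -> face D' x y w &
      forall x y w, face D x y w ->
        (forall z, open_triangle x y w z -> ~ Q z) -> face D' x y w].
  apply: (star_surgery T (E0 := del_edge E b c) (Q := Q)) => //.
  - by move=> x y [].
  - by apply: del_edge_sym; case: T.
  - by split; split=> //; case: T.
  - apply: seg_closed (tri_outer T) _ _ (open_seg_seg hp); apply: (tri_in T); exact: inV.
  - by right.
  - move=> z [[hz|hz]|hz]; last exact: del_edge_open_seg T bc hz.
      by move=> /del_edge_sub; apply: hD0.
    by move=> /del_edge_sub; apply: hD1.
  - move=> x z; have [s s01' ep] := hp.
    have half u v w : 0 < orient u v w -> open_seg u v p ->
        seg p w z -> [\/ open_triangle u v w z, z = w | z = p].
      move=> huvw hp' /segE[l /andP[l0 l1] ->].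
      have [->|n0] := eqVneq l 0; first by apply: Or33; rewrite comb2_id.
      have [->|n1] := eqVneq l 1; first by apply: Or32; rewrite comb2_id.
      have l0' : 0 < l by rewrite lt_def n0.
      have l1' : 0 < 1 - l by rewrite subr_gt0 lt_def eq_sym n1.
      have [q1 q2 q3] := open_seg_half huvw hp'.
      apply: Or31; apply/open_triangleP => //; rewrite !orient_comb2 q3 !orientxx.
      rewrite (orient_rot p v w) (orient_rotr u p w) !mulr0 !(addr0, add0r).
      by rewrite !mulr_gt0.
    have side u v : same_edge u v b c -> seg p u z -> Q z \/ z = u.
      move=> huv /segE[l /andP[l0 l1] ->].
      have [->|n1] := eqVneq l 1; first by right; rewrite comb2_id.
      left; right; have l1' : l < 1 by rewrite lt_def eq_sym n1.
      have [s0 s1] := andP s01'.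
      case: huv => -[-> _]; rewrite ep.
        exists (s * (1 - l)); last by rewrite /comb2 /=; congr pair; ring.
        by apply/andP; split; nra.
      exists (s + l * (1 - s)); last by rewrite /comb2 /=; congr pair; ring.
      by apply/andP; split; nra.
    rewrite !inE => /or4P[] /eqP ->.
    + by apply: (side b c); left.
    + by apply: (side c b); right.
    + move=> /(half _ _ _ h0 hp)[hz|->|->]; first by left; left; left.
        by right.
      by left; right.
    + move=> /(half _ _ _ h1 (open_segC hp))[hz|->|->]; first by left; left; right.
        by right.
      by left; right.
  - have mbc z : seg p b z -> seg p c z -> z = p.
      apply: (@seg_meet_side _ a p b c).
        by rewrite orient_swap (orient_rot b p a) oppr_lt0.
      by rewrite (orient_rotr p c a) ltW.
    have mad z : seg p a z -> seg p d z -> z = p.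
      move=> ha hd; apply: (@seg_meet_side _ b p d a) => //; last exact: ltW.
      by rewrite orient_swap oppr_lt0.
    have mab z : seg p a z -> seg p b z -> z = p.
      by apply: seg_meet; rewrite -(orient_rot a b p).
    have mca z : seg p c z -> seg p a z -> z = p.
      by apply: seg_meet; rewrite (orient_rot p c a).
    have mdc z : seg p d z -> seg p c z -> z = p.
      by apply: seg_meet; rewrite -(orient_rot d c p).
    have mbd z : seg p b z -> seg p d z -> z = p.
      by apply: seg_meet; rewrite (orient_rot p b d).
    move=> x y z; rewrite !inE => /or4P[] /eqP -> /or4P[] /eqP -> // _ hx hy.
    + exact: mbc.
    + exact: mab.
    + exact: mbd.
    + exact: mbc.
    + exact: mca.
    + exact: mdc.
    + exact: mab.
    + exact: mca.
    + exact: mad.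
    + exact: mbd.
    + exact: mdc.
    + exact: mad.
  - move=> z [[hz|hz]|hz]; last by left; apply: sbc; apply: open_seg_seg.
      by right; exists b, c, a; split=> // w hw; left; left.
    by right; exists c, b, d; split=> // w hw; left; right.
  - have off1' z : open_triangle c p d z \/ open_triangle p b d z ->
        forall x, x \in [:: b; c; a; d] -> ~ seg p x z.
      move=> hz x hx; apply: off1 => //; move: hx; rewrite !inE.
      by do 4 case: eqP => //.
    have sab' : seg a b `<=` D' by apply: subset_trans DD'.
    have sca' : seg c a `<=` D' by apply: subset_trans DD'.
    have sbd' : seg b d `<=` D' by apply: subset_trans DD'.
    have sdc' : seg d c `<=` D' by apply: subset_trans DD'.
    move=> x y w [|[|[|]]] [-> -> ->].
    + split=> //; [by move=> z /s01; left; left| |by split=> //; [apply: sN'|apply: sN]].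
      by move=> z hz; apply: off0; left.
    + split=> //; [by move=> z /s02; left; left| |by split=> //; [apply: sN|apply: sN']].
      by move=> z hz; apply: off0; right.
    + split=> //; [by move=> z /s11; left; right| |by split=> //; [apply: sN'|apply: sN]].
      by move=> z hz; apply: off1'; left.
    + split=> //; [by move=> z /s12; left; right| |by split=> //; [apply: sN|apply: sN']].
      by move=> z hz; apply: off1'; right.
  - move=> z [[/cov0|/cov1]|/open_seg_seg/(open_seg_split hp)].
    + case=> hz; [right|right|left; exact: sN hz].
        by exists b, p, a; split=> //; left.
      by exists p, c, a; split=> //; right; left.
    + case=> hz; [right|right|left; exact: sN hz].
        by exists c, p, d; split=> //; right; right; left.
      by exists p, b, d; split=> //; right; right; right.
    + by case=> hz; left; apply: sN hz.
split=> //.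
  by split; apply: hG; [left|right; left|right; right; left|right; right; right].
move=> x y w fD dis0 dis1; apply: hold => // z hz [[|]|]; [exact: dis0|exact: dis1|].
by move=> /open_seg_seg/sbc; case: fD => _ /(_ z hz).
Qed.

(* The union of the two faces and the open edge [b c] is the open convex
   quadrilateral [a b d c]. *)
Lemma flip_edge A B C V (E : pt -> pt -> Prop) a b c d :
  let D := drawn V E in
  let E' := fun x y => del_edge E b c x y \/ same_edge x y a d in
  let D' := drawn V E' in
  triangulated A B C V E -> face D b c a -> face D c b d -> E b c ->
  ~ same_edge A B b c -> ~ same_edge B C b c -> ~ same_edge C A b c ->
  a \in V -> d \in V -> 0 < orient a b d -> 0 < orient a d c ->
  [/\ triangulated A B C V E',
      face D' a b d, face D' a d c &
      forall x y w, face D x y w -> disjoint_triangles x y w b c a ->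
        disjoint_triangles x y w c b d -> face D' x y w].
Proof.
move=> D E' D' T f0 f1 bc nAB nBC nCA aV dV habd hadc.
have [h0 hD0 sbc sca sab] := f0; have [h1 hD1 scb sbd sdc] := f1.
have habc : 0 < orient a b c by rewrite (orient_rotr b c a).
have hbdc : 0 < orient b d c by rewrite (orient_rot c b d).
pose Q := [set z | [/\ 0 < orient a b z, 0 < orient b d z, 0 < orient d c z &
  0 < orient c a z]].
pose G x y w := (x, y, w) = (a, b, d) \/ (x, y, w) = (a, d, c).
have oQ : open Q.
  have -> : Q = [set z | 0 < orient a b z] `&` [set z | 0 < orient b d z] `&`
      [set z | 0 < orient d c z] `&` [set z | 0 < orient c a z].
    by apply/seteqP; split=> z => [[]|[[[]]]].
  by do ?apply: openI; apply: open_halfplane.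
have bda : 0 < orient b d a by rewrite (orient_rot a b d).
have dcb : 0 < orient d c b by rewrite (orient_rotr c b d).
have dca : 0 < orient d c a by rewrite (orient_rot a d c).
have cab : 0 < orient c a b by rewrite (orient_rot b c a).
have cad : 0 < orient c a d by rewrite (orient_rotr a d c).
have pos2 (l l' r s : R) : 0 < l -> 0 < l' -> 0 < r -> 0 < s -> 0 < l * r + l' * s.
  by move=> *; rewrite addr_gt0// mulr_gt0.
have subQ x y w :
    [\/ [/\ x = b, y = c & w = a], [/\ x = c, y = b & w = d],
        [/\ x = a, y = b & w = d] | [/\ x = a, y = d & w = c]] ->
    open_triangle x y w `<=` Q.
  move=> hxyw _ [l1 [l2 [l3 [? ? ? hs ->]]]].
  rewrite /Q /= -/(comb3 l1 l2 l3 x y w) !orient_comb3//.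
  by case: hxyw => -[-> -> ->]; rewrite !orientxx !mulr0 !(addr0, add0r);
    split; do ?[exact: mulr_gt0|exact: pos2].
have Qbc : open_seg b c `<=` Q.
  move=> _ [l /andP[l0 l1] ->]; have l2 : 0 < 1 - l by lra.
  rewrite /Q /= !orient_comb2 !orientxx !mulr0 !(addr0, add0r).
  by split; apply: mulr_gt0.
have Qad : open_seg a d `<=` Q.
  move=> _ [l /andP[l0 l1] ->]; have l2 : 0 < 1 - l by lra.
  rewrite /Q /= !orient_comb2 !orientxx !mulr0 !(addr0, add0r).
  by split; apply: mulr_gt0.
have Qcases z : Q z ->
    [\/ open_triangle b c a z, open_triangle c b d z | open_seg b c z].
  move=> [z1 z2 z3 z4]; have e : orient c b z = - orient b c z by rewrite orient_swap.
  have [s|s|s] := ltgtP (orient b c z) 0.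
  - by apply: Or32; apply/open_triangleP => //; split; rewrite // e oppr_gt0.
  - by apply: Or31; apply/open_triangleP.
  - apply: Or33; have /seg_cases[[]|//] : seg b c z.
      by apply: (seg_edge h0) => //; apply: ltW.
    + by move=> ez; move: z1; rewrite ez orientxx ltxx.
    + by move=> ez; move: z4; rewrite ez orientxx ltxx.
have adN x y z : same_edge x y a d -> seg x y z -> seg a d z.
  by move=> [[-> ->]|[-> ->]] // /segC.
have sad : seg a d `<=` D' by apply: seg_drawn; right; left.
have DD' z : D z -> D' z \/ Q z.
  case=> [zV|[x [y [hE hz]]]]; first by left; left.
  have [se|nse] := pselect (same_edge x y b c); last first.
    by left; right; exists x, y; split=> //; left.
  have /seg_cases[[]->|/Qbc] : seg b c z by case: se hz => -[-> ->] // /segC.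
  - by left; left; apply: (tri_mem T bc).
  - by left; left; apply: (tri_mem T (tri_sym T bc)).
  - by right.
(* Here the open edge [b c] really disappears, but the sides of the quadrilateral stay: on each of
   them one of the four strict inequalities defining [Q] is an equality. *)
have bnd x y : seg x y `<=` D -> [\/ same_edge x y a b, same_edge x y b d,
    same_edge x y d c | same_edge x y c a] -> seg x y `<=` D'.
  move=> hxy hc z hz; case: (DD' z (hxy _ hz)) => // -[z1 z2 z3 z4]; exfalso.
  have col u v : same_edge x y u v -> orient u v z = 0.
    have [l _ ->] := segE hz.
    by move=> [[-> ->]|[-> ->]]; rewrite orient_comb2 !orientxx !mulr0 addr0.
  by case: hc => /col; [move: z1|move: z2|move: z3|move: z4] => + e; rewrite e ltxx.
have [T' hG hold] : [/\ triangulated A B C V E',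
      forall x y w, G x y w -> face D' x y w &
      forall x y w, face D x y w ->
        (forall z, open_triangle x y w z -> ~ Q z) -> face D' x y w].
  apply: (surgery (P := [::]) T (E0 := del_edge E b c) (Q := Q)) => //.
  - by move=> x y [].
  - by apply: del_edge_sym; case: T.
  - by split; split=> //; case: T.
  - by case: T.
  - have nad : a <> d by move=> e; move: habd; rewrite e orientxx ltxx.
    by move=> x y [[-> ->]|[-> ->]]; split=> //; [right|left|move=> /esym].
  - move=> z /Qcases[hz|hz|hz]; last exact: del_edge_open_seg T bc hz.
      by move=> /del_edge_sub; apply: hD0.
    by move=> /del_edge_sub; apply: hD1.
  - move=> x y z e /(adN _ _ _ e) /seg_cases[he|/Qad]; last by left.
    right; case: e he => -[-> ->] [] ->; split=> //; do ?[by left|by right].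
  - move=> x y x' y' z e e' _ _; left.
    by case: e e' => -[-> ->] [[-> ->]|[-> ->]]; [left|right|right|left].
  - move=> z /Qcases[hz|hz|hz].
    + by right; exists b, c, a; split=> //; apply: subQ; apply: Or41.
    + by right; exists c, b, d; split=> //; apply: subQ; apply: Or42.
    + by left; apply: sbc; apply: open_seg_seg.
  - by move=> z /DD'[|hz]; [left|right; apply: open_nbhs_nbhs].
  - have off x y w z : 0 < orient x y w ->
        same_edge x y a d \/ same_edge y w a d \/ same_edge w x a d ->
        open_triangle x y w z -> forall u v, same_edge u v a d -> ~ seg u v z.
      move=> hxyw hc /open_triangleP-/(_ hxyw) [z1 z2 z3] u v /adN h /h.
      move=> /segE[l _ ez]; move: z1 z2 z3; rewrite ez !orient_comb2.
      by case: hc => [|[|]] [[-> ->]|[-> ->]]; rewrite !orientxx ?(mulr0, addr0, ltxx).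
    move=> x y w [] [-> -> ->]; split=> //.
    + by apply: subQ; apply: Or43.
    + move=> z hz; split=> //; apply: off hz => //.
      by right; right; right.
    + split; [apply: bnd => //|apply: bnd => //|by move=> z /segC/sad].
        by apply: Or41; left.
      by apply: Or42; left.
    + by apply: subQ; apply: Or44.
    + by move=> z hz; split=> //; apply: off hz => //; left; left.
    + split=> //; apply: bnd => //.
        by apply: Or43; left.
      by apply: Or44; left.
  - move=> z [z1 z2 z3 z4].
    have e : orient d a z = - orient a d z by rewrite orient_swap.
    have [s|s|s] := ltgtP (orient a d z) 0.
    + right; exists a, b, d; split; first by left.
      by apply/open_triangleP => //; split; rewrite // e oppr_gt0.
    + by right; exists a, d, c; split; [right|apply/open_triangleP].
    + by left; apply: sad; apply: (seg_edge hadc) => //; apply: ltW.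
split=> //; try by apply: hG; [left|right].
- by apply: hG; left.
- by apply: hG; right.
move=> x y w fD dis0 dis1; apply: hold => // z hz /Qcases[|| /open_seg_seg/sbc].
- exact: dis0.
- exact: dis1.
- by case: fD => _ /(_ z hz).
Qed.
End EdgeSurgeries.

(** * Angles and the routing step *)

Section Transfer.
Variable R : realType.
Notation pt := (R * R)%type.
Implicit Types (a b c d p q x y z : pt) (D U W Q : set pt).

Definition vpos (V : seq pt) (i : 'I_(size V)) : pt := nth 0 V i.
Definition vadj (V : seq pt) (E : pt -> pt -> Prop) : rel 'I_(size V) :=
  fun i j => `[< E (vpos i) (vpos j) >].

Lemma vpos_mem V (i : 'I_(size V)) : vpos i \in V.
Proof. exact: mem_nth. Qed.

Lemma vpos_surj V x : x \in V -> exists i : 'I_(size V), vpos i = x.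
Proof.
by move=> xV; have h := xV; rewrite -index_mem in h; exists (Ordinal h); apply: nth_index.
Qed.

Lemma vpos_inj V : uniq V -> injective (@vpos V).
Proof.
by move=> uV i j /eqP; rewrite /vpos nth_uniq// => /eqP /val_inj.
Qed.

Lemma drawingE A B C V E : triangulated A B C V E ->
  drawing (@vpos V) (@vadj V E) = drawn V E.
Proof.
move=> T; apply/seteqP; split=> z.
  move=> [[i _ <-]|[[i j] /= /asboolP hE hz]]; first by left; apply: vpos_mem.
  by right; exists (vpos i), (vpos j).
move=> [/vpos_surj[i <-]|[x [y [hE hz]]]]; first by left; exists i.
have [i hi] := vpos_surj (tri_mem T hE); have [j hj] := vpos_surj (tri_mem T (tri_sym T hE)).
by right; exists (i, j); rewrite /= ?hi ?hj//; apply/asboolP; rewrite hi hj.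
Qed.

Lemma triangulated_is_triangulation A B C V E : triangulated A B C V E ->
  is_triangulation (@vpos V) (@vadj V E).
Proof.
move=> T; have inj := vpos_inj (tri_uniq T); split; last first.
  move=> z; rewrite /face_of (drawingE T) => nDz.
  have [hz|hz] := pselect (closed_triangle A B C z).
    have [a [b [c [hf oz]]]] := tri_cov T hz nDz; exists a, b, c; split.
      by case: hf => + _ _ _ _; rewrite /collinear unlock => /gt_eqF/eqP.
    by left; apply: face_component.
  have hT := tri_outer T; exists A, B, C; split.
    by move: hT; rewrite /collinear unlock => /gt_eqF/eqP.
  (* For the outer face the two open sets of the bounded case change roles. *)
  right; apply: (component_clopen (W := open_triangle A B C)) => //.
  - exact: open_setC_closed_triangle.
  - exact: open_open_triangle.
  - exact: connected_setC_closed_triangle.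
  - move=> x hx [xV|[u [v [hE hs]]]]; first exact/hx/(tri_in T).
    apply: hx; apply: seg_closed hs => //; apply: (tri_in T).
      exact: (tri_mem T hE).
    exact: (tri_mem T (tri_sym T hE)).
  - move=> x nDx; have [cx|cx] := pselect (closed_triangle A B C x); last by left.
    case: (closed_boundary hT cx) => [?|hs|hs|hs]; first by right.
    + by case: nDx; right; exists A, B; split=> //; exact: (tri_AB T).
    + by case: nDx; right; exists B, C; split=> //; exact: (tri_BC T).
    + by case: nDx; right; exists C, A; split=> //; exact: (tri_CA T).
  - by move=> x hx /open_closed/hx.
split.
- split=> //.
  + by move=> i; apply/asboolP => /(tri_irr T).
  + by move=> i j; apply/asboolP/asboolP => /(tri_sym T).
- move=> u v w /asboolP hE /(tri_vtx T hE (vpos_mem w)).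
  by move=> [/inj ->|/inj ->]; [left|right].
- move=> u v x y z /asboolP hE /asboolP hE' ne hz hz'.
  case: (tri_cross T hE hE' hz hz') => [[[/inj eu /inj ev]|[/inj eu /inj ev]]|[h h']].
  + by case: ne; rewrite eu ev.
  + by case: ne; rewrite eu ev setUC.
  + have [w hw ew] : exists2 w, (w = u \/ w = v) & z = vpos w.
      by case: h => ->; [exists u|exists v] => //; [left|right].
    exists w => //; split=> //.
    by move: h'; rewrite ew => -[/inj|/inj]; [left|right].
Qed.

(** The argument in [0, 2 pi) of a nonzero vector (X, Y). By Lagrange's identity the pair (dot,
    cross) has as norm the product of the two norms, so [ccw_angle] depends on that pair alone. *)
Definition ang (X Y : R) : R :=
  if 0 <= Y then acos (X / Num.sqrt (X ^+ 2 + Y ^+ 2))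
  else 2 * pi - acos (X / Num.sqrt (X ^+ 2 + Y ^+ 2)).

Lemma ccw_angleE a b : ccw_angle a b = ang (dot a b) (cross a b).
Proof.
rewrite /ccw_angle /ang /vnorm -sqrtrM; last by rewrite addr_ge0// sqr_ge0.
have -> // : (a.1 ^+ 2 + a.2 ^+ 2) * (b.1 ^+ 2 + b.2 ^+ 2) = dot a b ^+ 2 + cross a b ^+ 2.
by rewrite /dot /cross; ring.
Qed.

Lemma cos_ratio_bound (X Y : R) : 0 < X ^+ 2 + Y ^+ 2 ->
  -1 <= X / Num.sqrt (X ^+ 2 + Y ^+ 2) <= 1.
Proof.
move=> h; have s0 : 0 < Num.sqrt (X ^+ 2 + Y ^+ 2) by rewrite sqrtr_gt0.
rewrite -ler_norml normrM normfV (gtr0_norm s0) ler_pdivrMr// mul1r -sqrtr_sqr.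
by rewrite ler_wsqrtr// lerDl sqr_ge0.
Qed.

(** The cross product condition says that (X1, Y1) comes first counterclockwise in the upper
    half-plane, where the cosine decreases with the angle. Squaring removes the roots but reverses
    the order of negative numbers, whence the cases on the signs of [X] and [X1]. *)
Lemma cos_ratio_le (X1 Y1 X Y : R) : 0 < Y1 -> 0 <= Y -> 0 < X ^+ 2 + Y ^+ 2 ->
  X * Y1 <= X1 * Y ->
  X / Num.sqrt (X ^+ 2 + Y ^+ 2) <= X1 / Num.sqrt (X1 ^+ 2 + Y1 ^+ 2).
Proof.
move=> hY1 hY h hXY.
have h1 : 0 < X1 ^+ 2 + Y1 ^+ 2 by rewrite ltr_wpDl ?sqr_ge0// exprn_gt0.
have s0 : 0 < Num.sqrt (X ^+ 2 + Y ^+ 2) by rewrite sqrtr_gt0.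
have s1 : 0 < Num.sqrt (X1 ^+ 2 + Y1 ^+ 2) by rewrite sqrtr_gt0.
rewrite ler_pdivrMr// mulrAC ler_pdivlMr//.
set s := Num.sqrt (X ^+ 2 + _) in s0 *; set s' := Num.sqrt _ in s1 *.
have es : s ^+ 2 = X ^+ 2 + Y ^+ 2 by rewrite sqr_sqrtr// ltW.
have es' : s' ^+ 2 = X1 ^+ 2 + Y1 ^+ 2 by rewrite sqr_sqrtr// ltW.
have [hX|hX] := ltP 0 X.
  have hX1 : 0 < X1.
    have p : 0 < X1 * Y by apply: lt_le_trans hXY; rewrite mulr_gt0.
    by rewrite ltNge; apply/negP => n; move: p; rewrite ltNge mulr_le0_ge0.
  have sq : (X * Y1) ^+ 2 <= (X1 * Y) ^+ 2.
    by rewrite ler_sqr// nnegrE mulr_ge0// ltW.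
  rewrite -ler_sqr ?nnegrE; last first.
  - by apply: mulr_ge0; apply: ltW.
  - by apply: mulr_ge0; apply: ltW.
  by rewrite !exprMn es es'; move: sq; rewrite !exprMn; lra.
have [hX1|hX1] := leP 0 X1.
  apply: (@le_trans _ _ 0); first by rewrite mulr_le0_ge0// ltW.
  by rewrite mulr_ge0// ltW.
have nX : 0 <= - X by rewrite oppr_ge0.
have nX1 : 0 <= - X1 by rewrite oppr_ge0 ltW.
have sq : (- X1 * Y) ^+ 2 <= (- X * Y1) ^+ 2.
  rewrite ler_sqr ?nnegrE; last first.
  - by apply: mulr_ge0 => //; apply: ltW.
  - by apply: mulr_ge0.
  by rewrite !mulNr lerN2.
rewrite -lerN2 -!mulNr -ler_sqr ?nnegrE; last first.
- by apply: mulr_ge0 => //; apply: ltW.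
- by apply: mulr_ge0 => //; apply: ltW.
by rewrite !exprMn es es'; move: sq; rewrite !exprMn !sqrrN; lra.
Qed.

Lemma acos_anti (r s : R) : -1 <= r <= 1 -> -1 <= s <= 1 -> r <= s -> acos s <= acos r.
Proof.
move=> hr hs rs; rewrite leNgt; apply/negP => h.
have [/andP[r0 r1] rK] := acos_def hr; have [/andP[s0 s1] sK] := acos_def hs.
have : cos (acos s) < cos (acos r).
  by rewrite ltr_cos ?in_itv /= ?r0 ?s0.
by rewrite rK sK ltNge rs.
Qed.

(** The first vector is strictly above the axis, so its angle is at most pi, whereas a vector below
    the axis has angle at least pi; cosines are compared only when [Y] is nonnegative. *)
Lemma ang_le (X1 Y1 X Y : R) : 0 < Y1 -> 0 < X ^+ 2 + Y ^+ 2 ->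
  (0 <= Y -> X * Y1 <= X1 * Y) -> ang X1 Y1 <= ang X Y.
Proof.
move=> hY1 h hc; have h1 : 0 < X1 ^+ 2 + Y1 ^+ 2 by rewrite ltr_wpDl ?sqr_ge0// exprn_gt0.
rewrite /ang (ltW hY1); case: ifPn => hY.
  by apply: acos_anti; rewrite ?cos_ratio_bound// cos_ratio_le// hc.
have b1 := acos_lepi (cos_ratio_bound h1); have b2 := acos_lepi (cos_ratio_bound h).
by lra.
Qed.

End Transfer.

(** * From faces to routing choices *)

Section Walk.
Variable R : realType.
Notation pt := (R * R)%type.
Implicit Types (a b c d p q x y z : pt).

(** A segment leaving [v] strictly between [a] and [b] starts inside the triangle, whose interior is
    not drawn. *)
Lemma face_cone V (E : pt -> pt -> Prop) v a b w :
  face (drawn V E) v a b -> E v w -> 0 < orient v a w -> 0 < orient v w b -> False.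
Proof.
move=> [h hD _ _ _] hE ha hb; set r := orient a b w.
have K0 : 0 < orient v a b + `|r| by apply: ltr_pwDl.
(* With K = [orient v a b], this gives l (K + |r|) = K/2, so the orientation against the side [a b],
   which is (1 - l) K + l r, is at least K/2. *)
pose l := orient v a b / (2 * (orient v a b + `|r|)).
have l0 : 0 < l by rewrite divr_gt0// mulr_gt0.
have lK : l * (orient v a b + `|r|) = orient v a b / 2.
  by rewrite /l; field; rewrite gt_eqF.
have r1 : - `|r| <= r by rewrite lerNl ler_normr lexx orbT.
have r0 : 0 <= `|r| := normr_ge0 r.
have lr : - (l * `|r|) <= l * r by rewrite -mulrN ler_pM2l.
have lr0 : 0 <= l * `|r| by rewrite mulr_ge0// ltW.
have l1 : l <= 1.
  by rewrite -(ler_pM2r h) mul1r; move: lK; rewrite mulrDr; lra.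
apply: (hD (comb2 l v w)); last first.
  by right; exists v, w; split=> //; exists l => //; rewrite ltW.
apply/open_triangleP => //; rewrite !orient_comb2 !orientxx -/r.
rewrite (orient_rot v a b) (orient_rotr v w b) !mulr0 !add0r.
split; [exact: mulr_gt0| |exact: mulr_gt0].
by move: lK; rewrite mulrDr; lra.
Qed.

Lemma dot_cross_gt0 a b : a != 0 -> b != 0 -> 0 < dot a b ^+ 2 + cross a b ^+ 2.
Proof.
have h x : x != 0 -> 0 < x.1 ^+ 2 + x.2 ^+ 2.
  case: x => x1 x2 hx; rewrite lt_def addr_ge0 ?sqr_ge0// andbT.
  rewrite paddr_eq0 ?sqr_ge0// !sqrf_eq0; apply: contra hx => /= /andP[/eqP -> /eqP ->].
  exact: eqxx.
move=> /h ha /h hb; have -> : dot a b ^+ 2 + cross a b ^+ 2 =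
    (a.1 ^+ 2 + a.2 ^+ 2) * (b.1 ^+ 2 + b.2 ^+ 2) by rewrite /dot /cross; ring.
exact: mulr_gt0.
Qed.

Lemma vsub_eq0 a b : a <> b -> vsub a b != 0.
Proof.
case: a => a1 a2; case: b => b1 b2 /= ab; apply/eqP => -[] /eqP; rewrite subr_eq0 => /eqP e1.
by move=> /eqP; rewrite subr_eq0 => /eqP e2; apply: ab; rewrite e1 e2.
Qed.

Lemma orient_cross a b c : cross (vsub b a) (vsub c a) = orient a b c.
Proof. by rewrite unlock. Qed.

(** The ray to [t] leaves [v] inside the face. A neighbour at a smaller angle than [a] or [b] would
    lie strictly inside the cone of the face, against [face_cone]. *)
Lemma cone_angles A B C V (E : pt -> pt -> Prop) t v a b w :
  triangulated A B C V E -> face (drawn V E) v a b ->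
  0 < orient v a t -> 0 < orient v t b -> E v w ->
  cw_angle (vsub t v) (vsub a v) <= cw_angle (vsub t v) (vsub w v) /\
  ccw_angle (vsub t v) (vsub b v) <= ccw_angle (vsub t v) (vsub w v).
Proof.
move=> T hf hat htb hE; have [hK _ _ _ _] := hf.
have e0 : vsub w v != 0 by apply: vsub_eq0 => /esym; apply: (tri_irr T hE).
have d0 : vsub t v != 0.
  by apply: vsub_eq0 => e; move: hat; rewrite e orientxx ltxx.
(* Three-term Plucker relation for the four directions at [v]; it yields the second inequality that
   [face_cone] asks for. *)
have id : orient v a b * orient v w t =
    orient v t b * orient v w a + orient v a t * orient v w b.
  by rewrite !orientE; ring.
have swap x y : orient v x y = - orient v y x by rewrite !orientE; ring.
have n0 : 0 <= dot (vsub t v) (vsub t v).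
  by rewrite /dot -!expr2 addr_ge0 ?sqr_ge0.
rewrite /cw_angle !ccw_angleE !orient_cross; split.
  apply: ang_le => //; first by rewrite -orient_cross; apply: dot_cross_gt0.
  move=> hY; rewrite -subr_ge0.
  (* The comparison of the two angles collapses to one sign, the squared distance from [v] to [t]
     being a factor. *)
  have -> : dot (vsub a v) (vsub t v) * orient v w t - dot (vsub w v) (vsub t v) * orient v a t
      = dot (vsub t v) (vsub t v) * orient v w a.
    by rewrite !orientE /dot /vsub /=; ring.
  rewrite mulr_ge0// leNgt; apply/negP => hwa.
  apply: (face_cone hf hE); first by rewrite swap oppr_gt0.
  rewrite -(pmulr_rgt0 _ hat).
  have h1 : 0 <= orient v a b * orient v w t by rewrite mulr_ge0// ltW.
  have h2 : orient v t b * orient v w a < 0 by rewrite pmulr_rlt0.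
  by lra.
apply: ang_le => //; first by rewrite -orient_cross; apply: dot_cross_gt0.
move=> hY; rewrite -subr_ge0.
have -> : dot (vsub t v) (vsub b v) * orient v t w - dot (vsub t v) (vsub w v) * orient v t b
    = dot (vsub t v) (vsub t v) * orient v b w.
  by rewrite !orientE /dot /vsub /=; ring.
rewrite mulr_ge0// leNgt; apply/negP => hbw.
have hwb : 0 < orient v w b by rewrite swap oppr_gt0.
apply: (face_cone hf hE) => //; rewrite swap oppr_gt0 -(pmulr_rlt0 _ htb).
have h1 : orient v a b * orient v w t <= 0 by rewrite pmulr_rle0// swap oppr_le0.
have h2 : 0 < orient v a t * orient v w b by rewrite mulr_gt0.
by lra.
Qed.

Lemma rc_next A B C V (E : pt -> pt -> Prop) (t v a b : 'I_(size V)) :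
  triangulated A B C V E -> face (drawn V E) (vpos v) (vpos a) (vpos b) ->
  E (vpos v) (vpos a) -> E (vpos v) (vpos b) ->
  0 < orient (vpos v) (vpos a) (vpos t) -> 0 < orient (vpos v) (vpos t) (vpos b) ->
  cw_t (@vpos R V) (@vadj R V E) t v a /\ ccw_t (@vpos R V) (@vadj R V E) t v b.
Proof.
move=> T hf hva hvb hat htb; split; (apply/andP; split; first exact/asboolP);
  apply/forallP => w; apply/implyP => /asboolP hw;
  by have [] := cone_angles T hf hat htb hw.
Qed.

(** * Survival of the walk from a potential *)

Section Potential.
Variables (n : nat) (pos : 'I_n -> pt) (adj : rel 'I_n) (s t : 'I_n).
Variables (phi : 'I_n -> R) (e : R).
Local Notation rc := (rc_step pos adj t).
Hypothesis phi01 : forall v, 0 <= phi v <= 1.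
Hypothesis phis : phi s = 1.
Hypothesis phit : phi t = 0.
Hypothesis e01 : 0 <= e <= 1.
Hypothesis phi_step : forall v, v != t -> (1 - e) * phi v <= \sum_w rc v w * phi w.

Lemma rc_step_ge0 v w : 0 <= rc v w.
Proof. by rewrite /rc_step addr_ge0// divr_ge0. Qed.

Lemma surv_ge0 k v : 0 <= surv pos adj s t k v.
Proof.
elim: k v => [|k IH] v /=; first by case: (_ && _).
case: ifP => // _; apply: sumr_ge0 => u _; apply: mulr_ge0 => //; exact: rc_step_ge0.
Qed.

(** Stopping at [t] costs nothing, since [phi] vanishes there, and every other step keeps at least a
    factor [1 - e] of the mean. *)
Lemma potential_surv k : (1 - e) ^+ k <= \sum_v surv pos adj s t k v * phi v.
Proof.
elim: k => [|k IH].
  rewrite expr0 (bigD1 s)//= phis mulr1 eqxx.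
  have -> : s != t by apply/eqP => st; move: phis; rewrite st phit => /eqP; rewrite eq_sym oner_eq0.
  rewrite lerDl; apply: sumr_ge0 => v _; apply: mulr_ge0; first by case: (_ && _).
  by case/andP: (phi01 v).
have -> : \sum_v surv pos adj s t k.+1 v * phi v =
    \sum_(v | v != t) surv pos adj s t k v * \sum_w rc v w * phi w.
  transitivity (\sum_w \sum_(v | v != t) surv pos adj s t k v * (rc v w * phi w)).
    apply: eq_bigr => w _ /=; case: eqP => [->|_].
      by rewrite phit mulr0 big1// => v _; rewrite !mulr0.
    by rewrite mulr_suml; apply: eq_bigr => v _; rewrite mulrA.
  by rewrite exchange_big /=; apply: eq_bigr => v _; rewrite mulr_sumr.
have : (1 - e) * (1 - e) ^+ k <= (1 - e) * \sum_v surv pos adj s t k v * phi v.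
  by rewrite ler_wpM2l// subr_ge0; case/andP: e01.
rewrite exprS => /le_trans; apply.
rewrite mulr_sumr (bigD1 t)//= phit !mulr0 add0r; apply: ler_sum => v vt.
by rewrite mulrCA ler_wpM2l ?surv_ge0// phi_step.
Qed.

(** As [phi <= 1], the mean of [phi] bounds the survival probability from below; Bernoulli's
    inequality linearizes the power. *)
Lemma surv_sum_ge k : 1 - k%:R * e <= \sum_v surv pos adj s t k v.
Proof.
have bern : 1 - k%:R * e <= (1 - e) ^+ k.
  have h0 : 0 <= 1 - e by rewrite subr_ge0; case/andP: e01.
  elim: k => [|k IH]; first by rewrite expr0 mul0r subr0.
  rewrite exprS; apply: le_trans (_ : (1 - e) * (1 - k%:R * e) <= _); last by rewrite ler_wpM2l.
  have : 0 <= k%:R * (e * e) by rewrite !mulr_ge0//; case/andP: e01.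
  by rewrite -natr1; lra.
apply: le_trans bern _; apply: le_trans (potential_surv k) _.
apply: ler_sum => v _; rewrite ler_piMr ?surv_ge0//; by case/andP: (phi01 v).
Qed.

(** Each of the first [m] tail probabilities is at least 1/2, and the other terms of the series are
    nonnegative. *)
Lemma expected_steps_ge (m : nat) : m%:R * e <= 1 / 2 ->
  ((m%:R / 2)%:E <= expected_steps pos adj s t)%E.
Proof.
move=> hm; have nn k : (0 <= (\sum_v surv pos adj s t k v)%:E)%E.
  by rewrite lee_fin; apply: sumr_ge0 => v _; apply: surv_ge0.
apply: le_trans (nneseries_lim_ge m _); last by move=> k _ _; apply: nn.
rewrite sumEFin lee_fin big_mkord.
have -> : m%:R / 2 = \sum_(k < m) (1 / 2 : R).
  by rewrite sumr_const card_ord -[RHS]mulr_natl; lra.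
apply: ler_sum => k _; apply: le_trans (surv_sum_ge k).
have : k%:R * e <= m%:R * e by rewrite ler_wpM2r ?ler_nat ?(ltnW (ltn_ord k))//; case/andP: e01.
by lra.
Qed.
End Potential.

Lemma rc_sum_ge n (pos : 'I_n -> pt) (adj : rel 'I_n) (t v a b : 'I_n) (phi : 'I_n -> R) :
  (forall w, 0 <= phi w) -> cw_t pos adj t v a -> ccw_t pos adj t v b ->
  (phi a + phi b) / 2 <= \sum_w rc_step pos adj t v w * phi w.
Proof.
move=> h0 ha hb.
have -> : \sum_w rc_step pos adj t v w * phi w =
    \sum_w (cw_t pos adj t v w)%:R / 2 * phi w +
    \sum_w (ccw_t pos adj t v w)%:R / 2 * phi w.
  by rewrite -big_split /=; apply: eq_bigr => w _; rewrite /rc_step mulrDl.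
rewrite mulrDl lerD//.
  rewrite (bigD1 a)//= ha mul1r mulrC lerDl sumr_ge0// => w _.
  by rewrite mulr_ge0// divr_ge0.
rewrite (bigD1 b)//= hb mul1r mulrC lerDl sumr_ge0// => w _.
by rewrite mulr_ge0// divr_ge0.
Qed.

End Walk.

(** * Fans and the pinwheel *)

Section Fans.
Variable R : realType.
Notation pt := (R * R)%type.
Implicit Types (a b c d p q t u m x y z : pt).

Definition triangle_edge A B C x y :=
  @same_edge R x y A B \/ same_edge x y B C \/ same_edge x y C A.

Lemma triangulated_triangle A B C : 0 < @orient R A B C ->
  triangulated A B C [:: A; B; C] (triangle_edge A B C) /\
  face (drawn [:: A; B; C] (triangle_edge A B C)) A B C.
Proof.
move=> hABC; set V := [:: A; B; C]; set E := triangle_edge A B C.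
have hBCA : 0 < orient B C A by rewrite (orient_rot A B C).
have hCAB : 0 < orient C A B by rewrite (orient_rotr A B C).
have nAB : A <> B by move=> e; move: hABC; rewrite e orientxx ltxx.
have nBC : B <> C by move=> e; move: hABC; rewrite e orientxx ltxx.
have nCA : C <> A by move=> e; move: hABC; rewrite e orientxx ltxx.
have Vin w : w \in V -> [\/ w = A, w = B | w = C].
  by rewrite !inE => /or3P[] /eqP ->; [apply: Or31|apply: Or32|apply: Or33].
have [AV BV CV] : [/\ A \in V, B \in V & C \in V] by rewrite !inE !eqxx !orbT.
have EAB : E A B by left; left.
have EBC : E B C by right; left; left.
have ECA : E C A by right; right; left.
have sE x y : E x y -> seg x y `<=` drawn V E.
  by move=> h z hz; right; exists x, y.
have clV w : w \in V -> closed_triangle A B C w.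
  by have [? ? ?] := closed_vertices hABC; move=> /Vin[] ->.
have hsub x y : E x y -> forall z, open_triangle A B C z -> ~ seg x y z.
  move=> hE z /open_triangleP-/(_ hABC) [z1 z2 z3].
  have h u v : same_edge x y u v -> seg x y z -> orient u v z = 0.
    move=> huv /segE[l _ ->]; case: huv => -[-> ->];
    by rewrite orient_comb2 !orientxx !mulr0 addr0.
  by case: hE => [|[]] /h H /H e; [move: z1|move: z2|move: z3]; rewrite e ltxx.
have hface : face (drawn V E) A B C.
  split=> //; try exact: sE.
  move=> z hz [zV|[x [y [/hsub h /(h z hz)]]]] //.
  move: hz => /open_triangleP-/(_ hABC) [].
  by case: (Vin z zV) => ->; rewrite !orientxx !ltxx.
split=> //; split=> //.
- rewrite /= !inE !negb_or andbT -andbA; apply/and3P; split; apply/eqP => //.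
  exact: nesym.
- by move=> x y [|[]] [[-> ->]|[-> ->]];
    [left; right|left; left|right; left; right|right; left; left
    |right; right; right|right; right; left].
- by move=> x y [|[]] [[-> ->]|[-> ->]] //; apply: nesym.
- by move=> x y [|[]] [[-> _]|[-> _]].
- have h u v w x : 0 < orient u v w -> [\/ x = u, x = v | x = w] -> seg u v x -> ends u v x.
    move=> huvw [] ->; [by left|by right|].
    by move=> /segE[l _ e]; move: huvw; rewrite e orient_comb2 !orientxx !mulr0 addr0 ltxx.
  have h' u v w x y z : 0 < orient u v w -> [\/ z = u, z = v | z = w] ->
      same_edge x y u v -> seg x y z -> ends x y z.
    move=> huvw hx [[-> ->]|[-> ->]]; first exact: h huvw hx.
    by move=> /segC/(h _ _ _ _ huvw hx) []; [right|left].
  move=> x y z hE /Vin hz hs.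
  case: hE => [|[]] hE.
  + exact: (h' A B C).
  + by apply: (h' B C A) => //; case: hz => ->; [apply: Or33|apply: Or31|apply: Or32].
  + by apply: (h' C A B) => //; case: hz => ->; [apply: Or32|apply: Or33|apply: Or31].
- have mA z : seg A B z -> seg A C z -> z = A by apply: seg_meet.
  have mB z : seg B C z -> seg B A z -> z = B by apply: seg_meet.
  have mC z : seg C A z -> seg C B z -> z = C by apply: seg_meet.
  have h u v x y z : same_edge x y u v -> seg x y z -> seg u v z /\ (ends u v z -> ends x y z).
    move=> [[-> ->]|[-> ->]] // /segC hz; split=> // -[]; [by right|by left].
  have same u v x y x' y' : same_edge x y u v -> same_edge x' y' u v -> same_edge x y x' y'.
    by move=> [[-> ->]|[-> ->]] [[-> ->]|[-> ->]]; [left|right|right|left].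
  move=> x y x' y' z [|[]] hE [|[]] hE' /(h _ _ _ _ _ hE)[hz ez] /(h _ _ _ _ _ hE')[hz' ez'].
  + by left; apply: same hE hE'.
  + right; have ze := mB z hz' (segC hz).
    by split; [apply: ez; right|apply: ez'; left].
  + right; have ze := mA z hz (segC hz').
    by split; [apply: ez; left|apply: ez'; right].
  + right; have ze := mB z hz (segC hz').
    by split; [apply: ez; left|apply: ez'; right].
  + by left; apply: same hE hE'.
  + right; have ze := mC z hz' (segC hz).
    by split; [apply: ez; right|apply: ez'; left].
  + right; have ze := mA z hz' (segC hz).
    by split; [apply: ez; right|apply: ez'; left].
  + right; have ze := mC z hz (segC hz').
    by split; [apply: ez; left|apply: ez'; right].
  + by left; apply: same hE hE'.
- move=> z hz nD; exists A, B, C; split=> //.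
  case: (closed_boundary hABC hz) => // hs; case: nD.
  + exact: sE EAB _ hs.
  + exact: sE EBC _ hs.
  + exact: sE ECA _ hs.
Qed.

(** Repeated midpoints, counted from [m] at j = 0 towards [u]. With this spacing the parameter of
    [w_j] is exactly what the potential lacks from 1, so the potential is affine along an arm. *)
Definition spoke u m (j : nat) : pt := comb2 ((1 / 2) ^+ j) u m.

Lemma spoke0 u m : spoke u m 0 = m.
Proof. by rewrite /spoke expr0 comb2_id. Qed.

Lemma spokeS u m j : spoke u (spoke u m 1) j = spoke u m j.+1.
Proof. rewrite /spoke expr1 exprSr; move: ((1 / 2 : R) ^+ j) (1 / 2 : R) => r h.
by rewrite /comb2 /=; congr pair; ring. Qed.

Lemma half_pow_bounds j : 0 < (1 / 2 : R) ^+ j <= 1.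
Proof.
elim: j => [|j IH]; first by rewrite expr0; lra.
by rewrite exprS; lra.
Qed.

(** Certificate, by orientations alone, for a toss at [v]: the ray to [t] enters the face [v a b],
    so [a] comes first clockwise and [b] first counterclockwise. *)
Definition next_hop V (E : pt -> pt -> Prop) t v a b :=
  [/\ E v a, E v b, face (drawn V E) v a b, 0 < orient v a t & 0 < orient v t b].

Definition fan V (E : pt -> pt -> Prop) t u a m k :=
  next_hop V E t u a (spoke u m k) /\
  forall j, (j < k)%N -> next_hop V E t (spoke u m j.+1) a (spoke u m j).

Definition preserves V (E : pt -> pt -> Prop) V' (E' : pt -> pt -> Prop) u a m d :=
  [/\ {subset V <= V'}, (forall x y, E x y -> ~ same_edge x y u m -> E' x y) &
  forall x y z, face (drawn V E) x y z -> disjoint_triangles x y z m u a ->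
    disjoint_triangles x y z u m d -> face (drawn V' E') x y z].

(** Each round inserts the midpoint [p] of [m u] and continues on the half [p u], whose two faces
    keep the apexes [a] and [d]; by [spokeS] the later points are those of the original arm, shifted
    by one. The rounds move towards [u], so the face [p a m] through which [p] routes is not touched
    again. *)
Lemma build_fan A B C t u a d k V (E : pt -> pt -> Prop) m :
  triangulated A B C V E -> face (drawn V E) m u a -> face (drawn V E) u m d ->
  E m u -> E m a -> E u a -> a \in V -> d \in V -> m <> A -> m <> B -> m <> C ->
  0 < orient u a t -> 0 < orient m a t -> 0 < orient u t m ->
  exists V' E', [/\ triangulated A B C V' E', size V' = (size V + k)%N,
    (forall x, x \in V' -> x \in V \/ exists2 j, (j < k)%N & x = spoke u m j.+1),
    fan V' E' t u a m k & preserves V E V' E' u a m d].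
Proof.
elim: k V E m => [|k IH] V E m T f0 f1 Emu Ema Eua aV dV mA mB mC hu hm hum.
  exists V, E; split; [by []|by rewrite addn0|by left| |by split].
  split; last by [].
  by rewrite spoke0; split=> //; [exact: (tri_sym T)|exact: face_rot f0].
have nmu := tri_irr T Emu; have nma := tri_irr T Ema; have nua := tri_irr T Eua.
pose p := spoke u m 1.
have pE : p = comb2 (1 / 2) u m by rewrite /p /spoke expr1.
have hpum : open_seg u m p by exists (1 / 2) => //; lra.
have hp := open_segC hpum.
have [AV BV CV] : [/\ A \in V, B \in V & C \in V].
  split; [exact: (tri_mem T (tri_AB T))|exact: (tri_mem T (tri_BC T))|].
  exact: (tri_mem T (tri_CA T)).
have uV := tri_mem T Eua; have mV := tri_mem T Emu.
have nse x y : x <> m -> y <> m -> ~ same_edge x y m u.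
  by move=> xm ym [[e _]|[_ e]].
have [T1 pV [g1 g2 g3 g4] pers] := split_edge T f0 f1 Emu
  (nse _ _ (nesym mA) (nesym mB)) (nse _ _ (nesym mB) (nesym mC))
  (nse _ _ (nesym mC) (nesym mA)) aV dV hp.
set V1 := p :: V in T1 g1 g2 g3 g4 pers.
set E1 := add_star _ _ _ in T1 g1 g2 g3 g4 pers.
have pne x : x \in V -> p <> x by move=> xV e; rewrite e xV in pV.
have E1p x : x \in [:: m; u; a; d] -> E1 p x by move=> hx; right; left.
have E1pu : E1 p u by apply: E1p; rewrite !inE eqxx orbT.
have E1pa : E1 p a by apply: E1p; rewrite !inE eqxx !orbT.
have E1pm : E1 p m by apply: E1p; rewrite !inE eqxx.
have EE1 x y : E x y -> ~ same_edge x y u m -> E1 x y.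
  by move=> h ne; left; split=> // -[[e1 e2]|[e1 e2]]; apply: ne; [right|left].
have E1ua : E1 u a.
  by apply: EE1 => // -[[_ e]|[e _]]; [apply: nma|apply: nmu].
have hpa : 0 < orient p a t.
  have -> : orient p a t = 1 / 2 * orient u a t + 1 / 2 * orient m a t.
    by rewrite pE !orientE /=; field.
  by lra.
have hup : 0 < orient u t p.
  have -> : orient u t p = 1 / 2 * orient u t m by rewrite pE !orientE /=; field.
  by lra.
have [V' [E' [T' sz mem hfan [sub ee pers']]]] :
  exists V' E', [/\ triangulated A B C V' E', size V' = (size V1 + k)%N,
    (forall x, x \in V' -> x \in V1 \/ exists2 j, (j < k)%N & x = spoke u p j.+1),
    fan V' E' t u a p k & preserves V1 E1 V' E' u a p d].
  by apply: IH => //; rewrite ?inE ?aV ?dV ?orbT//; exact: pne.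
have [h0 _ _ _ _] := f0; have [h1 _ _ _ _] := f1.
have h0' : orient u m a < 0 by rewrite orient_swap oppr_lt0.
have h1' : orient m u d < 0 by rewrite orient_swap oppr_lt0.
have [s01 s02 _ _] := half_split h0 h1' hp.
have [s11 s12 _ _] := half_split h1 h0' hpum.
exists V', E'; split=> //.
- by rewrite sz /= addnS addSn.
- move=> x /mem [|[j jk ->]].
    by rewrite inE => /predU1P[->|]; [right; exists 0%N|left].
  by right; exists j.+1; rewrite ?spokeS.
- have [n0 nS] := hfan; split; first by move: n0; rewrite spokeS.
  move=> [_|j jk]; last by have := nS j jk; rewrite !spokeS.
  rewrite spoke0 -/p; split=> //.
  + by apply: ee => // -[[e _]|[_ e]]; [apply: (pne u)|apply: nua].
  + by apply: ee => // -[[e _]|[_ e]]; [apply: (pne u)|apply: nmu].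
  + have [q1 _ _ _ _] := g1; have [q2 _ _ _ _] := g2; have [q3 _ _ _ _] := g3.
    apply: pers'; first exact: face_rot g1.
      have q1' : 0 < orient p a m by rewrite (orient_rot m p a).
      move=> z /open_triangleP-/(_ q1') [z1 _ _] /open_triangleP-/(_ q2) [_ _].
      by rewrite orient_swap oppr_gt0 ltNge ltW.
    have q1' : 0 < orient p a m by rewrite (orient_rot m p a).
    move=> z /open_triangleP-/(_ q1') [_ _ z3] /open_triangleP-/(_ q3) [].
    have -> : orient u p z = - orient m p z by rewrite pE !orientE /=; field.
    by rewrite oppr_gt0 ltNge ltW.
  + have -> : orient p t m = 1 / 2 * orient u t m by rewrite pE !orientE /=; field.
    by lra.
- split.
  + by move=> x xV; apply: sub; rewrite inE xV orbT.
  + move=> x y hE ne; apply: ee; first exact: EE1.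
    move=> [[_ e]|[e _]].
      by apply: (pne y) => //; apply: (tri_mem T (tri_sym T hE)).
    by apply: (pne x) => //; apply: (tri_mem T hE).
  + move=> x y z hf d0 d1; apply: pers'; first exact: pers.
      by move=> w /d0 hw /s02.
    by move=> w /d1 hw /s11.
Qed.

Lemma fan_sub u a m k j : 0 < orient m u a ->
  open_triangle u a (spoke u m k) `<=` open_triangle m u a /\
  open_triangle (spoke u m j.+1) a (spoke u m j) `<=` open_triangle m u a.
Proof.
move=> h; have [clm clu cla] := closed_vertices h.
have hw i : closed_triangle m u a (spoke u m i).
  apply: (seg_closed h clu clm); exists ((1 / 2) ^+ i) => //.
  by case/andP: (half_pow_bounds i) => /ltW ->.
split; apply: open_sub => //.
  have -> : orient u a (spoke u m k) = (1 / 2) ^+ k * orient m u a.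
    by rewrite /spoke !orientE /=; ring.
  by rewrite mulr_gt0//; case/andP: (half_pow_bounds k).
have -> : orient (spoke u m j.+1) a (spoke u m j) = (1 / 2) ^+ j * (1 / 2) * orient m u a.
  by rewrite /spoke exprS !orientE /=; field.
by rewrite !mulr_gt0//; case/andP: (half_pow_bounds j).
Qed.

(** The range of [h] reaches [u] and all the [w_(j+1)], the vertices from which the fan routes, and
    stops before [m]. None of them is an end of the edge subdivided elsewhere, so their edges
    survive. *)
Lemma fan_preserved V (E : pt -> pt -> Prop) V' (E' : pt -> pt -> Prop) t u a m k u' a' m' d' :
  preserves V E V' E' u' a' m' d' -> 0 < orient m u a ->
  disjoint_triangles m u a m' u' a' -> disjoint_triangles m u a u' m' d' ->
  (forall h, 0 <= h < 1 -> comb2 h u m <> u' /\ comb2 h u m <> m') ->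
  fan V E t u a m k -> fan V' E' t u a m k.
Proof.
move=> [_ hE hf] h d1 d2 ne [n0 nS].
have pn v x y : v <> u' /\ v <> m' -> open_triangle v x y `<=` open_triangle m u a ->
    next_hop V E t v x y -> next_hop V' E' t v x y.
  move=> [nu nm] sub [e1 e2 f q1 q2].
  have nse w : ~ same_edge v w u' m' by move=> [[]|[]].
  split=> //; do ?exact: hE.
  by apply: hf => // z /sub; [apply: d1|apply: d2].
have [s0 _] := fan_sub k 0 h; split.
  apply: pn n0 => //; rewrite -[u](comb2_id u m).1; apply: ne; lra.
move=> j jk; have [_ sS] := fan_sub k j h; apply: pn (nS j jk) => //.
apply: ne; rewrite exprS; case/andP: (half_pow_bounds j) => *; lra.
Qed.

End Fans.

(** * The pinwheel, its arms and its potential *)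

Section Pinwheel.
Variable R : realType.
Notation pt := (R * R)%type.
Implicit Types (a b c d p q t u m x y z : pt).

(** The linear map (x, y) -> (-y, x - y), of order three, permutes the [ui] and the [mi] cyclically
    and fixes the hub. Explicit coordinates leave the position checks to linear arithmetic. *)
Definition u1 : pt := (8, 0).
Definition u2 : pt := (0, 8).
Definition u3 : pt := (-8, -8).
Definition m1 : pt := (2, -1).
Definition m2 : pt := (1, 3).
Definition m3 : pt := (-3, -2).
Definition hub : pt := (0, 0).

Ltac coords := rewrite ?orientE /comb2 /u1 /u2 /u3 /m1 /m2 /m3 /hub /=.

(* [lra] fails on hypotheses that are equations in other types. *)
Ltac coord_lra := repeat match goal with
  | H : @eq nat _ _ |- _ => clear H
  | H : @eq (R * R) _ _ |- _ => clear H end; lra.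

Ltac neq := let e := fresh in move=> e; move: (congr1 fst e) (congr1 snd e); clear e;
  coords; move=> *; coord_lra.

(** Disjointness becomes the infeasibility of six strict inequalities, linear in the coordinates of
    [z] once the corners are explicit. *)
Lemma disjoint_trianglesP x y w a b c : 0 < orient x y w -> 0 < orient a b c ->
  (forall z, 0 < orient x y z -> 0 < orient y w z -> 0 < orient w x z ->
    0 < orient a b z -> 0 < orient b c z -> 0 < orient c a z -> False) ->
  @disjoint_triangles R x y w a b c.
Proof.
move=> h h' H z /open_triangleP-/(_ h) [? ? ?] /open_triangleP-/(_ h') [? ? ?].
exact: (H z).
Qed.

Ltac dis := apply: disjoint_trianglesP;
  [coords; coord_lra|coords; coord_lra|let z := fresh in move=> z; coords; move=> *; coord_lra].

Ltac inside := apply/open_triangleP; [coords; coord_lra|coords; split; coord_lra].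

Ltac subs := let x := fresh in move=> x; rewrite !inE => /or3P[] /eqP ->;
  rewrite ?eqxx ?orbT.

Ltac nse := let e := fresh in let e1 := fresh in let e2 := fresh in
  move=> e; case: e => -[e1 e2]; move: (congr1 fst e1) (congr1 snd e1)
    (congr1 fst e2) (congr1 snd e2); clear e1 e2; coords; move=> *; coord_lra.

(** Without the hub the graph is an octahedron. All its degrees are four, so repeated stacking,
    which ends with a vertex of degree three, cannot produce it; hence the flip. *)
Lemma pinwheel : exists E,
  let V := [:: hub; m3; m2; m1; u1; u2; u3] in
  [/\ triangulated u1 u2 u3 V E,
    [/\ E u1 u2, E u2 u3 & E u3 u1],
    [/\ E m1 u1, E m2 u2, E m3 u3, E m1 u2 & E m2 u3 /\ E m3 u1],
    [/\ face (drawn V E) m1 u1 u2, face (drawn V E) m2 u2 u3 & face (drawn V E) m3 u3 u1] &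
    [/\ face (drawn V E) u1 m1 m3, face (drawn V E) u2 m2 m1 & face (drawn V E) u3 m3 m2]].
Proof.
have [|T0 f0] := @triangulated_triangle R u1 u2 u3; first by coords; lra.
move: T0 f0; set E0 := triangle_edge _ _ _ => T0 f0.
have [| |T1 [f1 f2 f3] pers1] := stack (p := m1) T0 f0; [by subs|by inside|].
move: T1 f1 f2 f3 pers1; set V1 := m1 :: _; set E1 := add_star _ _ _ => T1 f1 f2 f3 pers1.
have [| |T2 [g1 g2 g3] pers2] := stack (p := m2) T1 f2; [by subs|by inside|].
move: T2 g1 g2 g3 pers2; set V2 := m2 :: _; set E2 := add_star _ _ _ => T2 g1 g2 g3 pers2.
have f1_2 := pers2 _ _ _ f1 ltac:(dis).
have f3_2 := pers2 _ _ _ f3 ltac:(dis).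
have [| |T3 [h1 h2 h3] pers3] := stack (p := m3) T2 (face_rot (face_rot g3)).
- by subs.
- by inside.
move: T3 h1 h2 h3 pers3; set V3 := m3 :: _; set E3 := add_star _ _ _ => T3 h1 h2 h3 pers3.
have f1_3 := pers3 _ _ _ f1_2 ltac:(dis).
have f3_3 := pers3 _ _ _ f3_2 ltac:(dis).
have g1_3 := pers3 _ _ _ g1 ltac:(dis).
have g2_3 := pers3 _ _ _ g2 ltac:(dis).
have star_in (E : pt -> pt -> Prop) p N x : x \in N -> add_star E p N p x.
  by move=> ?; right; left.
(* Stacked first, [m1] was joined to all three [ui]; the twist wants [m3 u1] in place of [u3 m1]. *)
have E3um : E3 u3 m1.
  by apply: (tri_sym T3); left; left; apply: star_in; rewrite !inE eqxx ?orbT.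
have [|||||||T4 k1 k2 pers4] := flip_edge (a := m3) (d := u1) T3 (face_rot h3) f3_3 E3um.
- by nse.
- by nse.
- by nse.
- by rewrite !inE eqxx ?orbT.
- by rewrite !inE eqxx ?orbT.
- by coords; lra.
- by coords; lra.
move: T4 k1 k2 pers4; set E4 := fun x y => _ => T4 k1 k2 pers4.
have f1_4 := pers4 _ _ _ f1_3 ltac:(dis) ltac:(dis).
have g1_4 := pers4 _ _ _ g1_3 ltac:(dis) ltac:(dis).
have g2_4 := pers4 _ _ _ g2_3 ltac:(dis) ltac:(dis).
have h1_4 := pers4 _ _ _ h1 ltac:(dis) ltac:(dis).
have h2_4 := pers4 _ _ _ h2 ltac:(dis) ltac:(dis).
have [| |T5 _ pers5] := stack (p := hub) T4 h1_4; [by subs|by inside|].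
move: T5 pers5; set E5 := add_star _ _ _ => T5 pers5.
have E35 x y : E3 x y -> ~ same_edge x y u3 m1 -> E5 x y by move=> h ne; left; left.
exists E5; split.
- exact: T5.
- by split; [apply: (tri_AB T5)|apply: (tri_BC T5)|apply: (tri_CA T5)].
- split; last split.
  + by apply: E35; [left; left; apply: star_in; rewrite !inE eqxx ?orbT|nse].
  + by apply: E35; [left; apply: star_in; rewrite !inE eqxx ?orbT|nse].
  + by apply: E35; [apply: star_in; rewrite !inE eqxx ?orbT|nse].
  + by apply: E35; [left; left; apply: star_in; rewrite !inE eqxx ?orbT|nse].
  + by apply: E35; [left; apply: star_in; rewrite !inE eqxx ?orbT|nse].
  + by left; right; left.
- by split; apply: pers5; do ?[dis|exact: f1_4|exact: g2_4|exact: k1].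
- split; apply: pers5; try dis.
  + exact: (face_rot k2).
  + exact: (face_rot (face_rot g1_4)).
  + exact: (face_rot (face_rot h2_4)).
Qed.

(** Three independent lengths let the number of vertices have any residue modulo three. The pairs of
    faces at the three arms are disjoint, so subdividing one arm leaves the others intact. *)
Lemma pinwheel_fans k1 k2 k3 : exists V E,
  [/\ triangulated u1 u2 u3 V E, size V = (7 + k1 + k2 + k3)%N,
    {subset [:: hub; m3; m2; m1; u1; u2; u3] <= V},
    (forall x, x \in V -> x \in [:: hub; m3; m2; m1; u1; u2; u3] \/
       [\/ exists2 j, (j < k1)%N & x = spoke u1 m1 j.+1,
           exists2 j, (j < k2)%N & x = spoke u2 m2 j.+1 |
           exists2 j, (j < k3)%N & x = spoke u3 m3 j.+1]) &
    [/\ fan V E hub u1 u2 m1 k1, fan V E hub u2 u3 m2 k2 & fan V E hub u3 u1 m3 k3]].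
Proof.
have [E0 [T0 [E12 E23 E31] [Em1 Em2 Em3 Em1' [Em2' Em3']] [f1 f2 f3] [g1 g2 g3]]] := pinwheel.
move: T0 f1 f2 f3 g1 g2 g3; set V0 := [:: hub; _; _; _; _; _; _] => T0 f1 f2 f3 g1 g2 g3.
have [||||||||V1 [E1 [T1 sz1 mem1 fan1 [sub1 ee1 ff1]]]] :=
  build_fan (t := hub) (d := m3) k1 T0 f1 g1 Em1 Em1' E12.
- by rewrite !inE eqxx ?orbT.
- by rewrite !inE eqxx ?orbT.
- by neq.
- by neq.
- by neq.
- by coords; coord_lra.
- by coords; coord_lra.
- by coords; coord_lra.
have f2_1 := ff1 _ _ _ f2 ltac:(dis) ltac:(dis).
have g2_1 := ff1 _ _ _ g2 ltac:(dis) ltac:(dis).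
have f3_1 := ff1 _ _ _ f3 ltac:(dis) ltac:(dis).
have g3_1 := ff1 _ _ _ g3 ltac:(dis) ltac:(dis).
have [||||||||V2 [E2 [T2 sz2 mem2 fan2 pres2]]] :=
  build_fan (t := hub) (d := m1) k2 T1 f2_1 g2_1 (ee1 _ _ Em2 ltac:(nse))
    (ee1 _ _ Em2' ltac:(nse)) (ee1 _ _ E23 ltac:(nse)).
- by apply: sub1; rewrite !inE eqxx ?orbT.
- by apply: sub1; rewrite !inE eqxx ?orbT.
- by neq.
- by neq.
- by neq.
- by coords; coord_lra.
- by coords; coord_lra.
- by coords; coord_lra.
have [sub2 ee2 ff2] := pres2.
have f3_2 := ff2 _ _ _ f3_1 ltac:(dis) ltac:(dis).
have g3_2 := ff2 _ _ _ g3_1 ltac:(dis) ltac:(dis).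
have [||||||||V3 [E3 [T3 sz3 mem3 fan3 pres3]]] :=
  build_fan (t := hub) (d := m2) k3 T2 f3_2 g3_2
    (ee2 _ _ (ee1 _ _ Em3 ltac:(nse)) ltac:(nse))
    (ee2 _ _ (ee1 _ _ Em3' ltac:(nse)) ltac:(nse))
    (ee2 _ _ (ee1 _ _ E31 ltac:(nse)) ltac:(nse)).
- by apply: sub2; apply: sub1; rewrite !inE eqxx ?orbT.
- by apply: sub2; apply: sub1; rewrite !inE eqxx ?orbT.
- by neq.
- by neq.
- by neq.
- by coords; coord_lra.
- by coords; coord_lra.
- by coords; coord_lra.
have [sub3 _ _] := pres3.
exists V3, E3; split=> //.
- by rewrite sz3 sz2 sz1.
- by move=> x /sub1/sub2/sub3.
- move=> x /mem3[/mem2[/mem1[|]|]|]; first by left.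
  + by right; apply: Or31.
  + by right; apply: Or32.
  + by right; apply: Or33.
have p1 : 0 < orient m1 u1 u2 by coords; coord_lra.
have p2 : 0 < orient m2 u2 u3 by coords; coord_lra.
split=> //.
- apply: (fan_preserved pres3) => //; [dis|dis|by move=> h /andP[h0 h1]; split; neq|].
  by apply: (fan_preserved pres2) => //; [dis|dis|by move=> h /andP[h0 h1]; split; neq].
- by apply: (fan_preserved pres3) => //; [dis|dis|by move=> h /andP[h0 h1]; split; neq].
Qed.

(** Read off from the position alone, so that no vertex needs a label. The point [comb2 h ui mi]
    lies on the i-th line, its parameter [h] being [- z.2], [z.1] and [z.2 - z.1] for the three
    arms, and receives [1 - h]. The arms are disjoint, so the order of the tests does not matter. *)
Definition potential z : R :=
  if [&& z.1 == 8 + 6 * z.2, 0 <= - z.2 & - z.2 <= 1] then 1 + z.2 else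
  if [&& z.2 == 8 - 5 * z.1, 0 <= z.1 & z.1 <= 1] then 1 - z.1 else
  if [&& z.1 == -8 + 5 * (z.2 - z.1), 0 <= z.2 - z.1 & z.2 - z.1 <= 1] then 1 - (z.2 - z.1)
  else 0.

Lemma potential01 z : 0 <= potential z <= 1.
Proof.
by rewrite /potential; do 3 (case: ifP => [/and3P[_ ? ?]|_]; first by lra); lra.
Qed.

Lemma potential_hub : potential hub = 0.
Proof.
by rewrite /potential /=; do 3 (case: ifP => [/and3P[/eqP ? ? ?]|_]; first by lra).
Qed.

Lemma potential_spoke h : 0 <= h <= 1 ->
  [/\ potential (comb2 h u1 m1) = 1 - h, potential (comb2 h u2 m2) = 1 - h &
      potential (comb2 h u3 m3) = 1 - h].
Proof.
have on (r s i j w : R) : i = j -> 0 <= w -> w <= 1 ->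
    (if [&& i == j, 0 <= w & w <= 1] then r else s) = r.
  by move=> -> -> ->; rewrite eqxx.
have off (r s i j w : R) : ~ [/\ i = j, 0 <= w & w <= 1] ->
    (if [&& i == j, 0 <= w & w <= 1] then r else s) = s.
  by move=> n; case: ifP => // /and3P[/eqP ? ? ?]; case: n.
move=> /andP[h0 h1]; split; rewrite /potential; coords.
- by rewrite [LHS]on; lra.
- rewrite [LHS]off; last by move=> [? ? ?]; lra.
  by rewrite [LHS]on; lra.
- rewrite [LHS]off; last by move=> [? ? ?]; lra.
  rewrite [LHS]off; last by move=> [? ? ?]; lra.
  by rewrite [LHS]on; lra.
Qed.

Lemma next_step A B C V (E : pt -> pt -> Prop) (e : R) (v : 'I_(size V)) t a b
    (ht : 'I_(size V)) :
  triangulated A B C V E -> vpos ht = t -> next_hop V E t (vpos v) a b ->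
  (1 - e) * potential (vpos v) <= (potential a + potential b) / 2 ->
  (1 - e) * potential (vpos v) <=
  \sum_w rc_step (@vpos R V) (@vadj R V E) ht v w * potential (vpos w).
Proof.
move=> T et [Ea Eb hf hat htb] /le_trans; apply.
have [i ei] := vpos_surj (tri_mem T (tri_sym T Ea)).
have [j ej] := vpos_surj (tri_mem T (tri_sym T Eb)).
rewrite -et -ei -ej in Ea Eb hf hat htb *.
have [ha hb] := rc_next T hf Ea Eb hat htb.
apply: (rc_sum_ge (phi := fun w => potential (vpos w))) ha hb => w.
by case/andP: (potential01 (vpos w)).
Qed.

(** The rate is set by [k], a common lower bound for the lengths of the arms, since only the tosses
    at the [ui] lose potential. *)
Lemma pinwheel_steps V (E : pt -> pt -> Prop) k1 k2 k3 k (m : nat) (s t : 'I_(size V)) :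
  triangulated u1 u2 u3 V E ->
  (forall x, x \in V -> x \in [:: hub; m3; m2; m1; u1; u2; u3] \/
     [\/ exists2 j, (j < k1)%N & x = spoke u1 m1 j.+1,
         exists2 j, (j < k2)%N & x = spoke u2 m2 j.+1 |
         exists2 j, (j < k3)%N & x = spoke u3 m3 j.+1]) ->
  [/\ fan V E hub u1 u2 m1 k1, fan V E hub u2 u3 m2 k2 & fan V E hub u3 u1 m3 k3] ->
  (k <= k1)%N -> (k <= k2)%N -> (k <= k3)%N ->
  vpos s = u1 -> vpos t = hub -> m%:R * (1 / 2 : R) ^+ k <= 1 / 2 ->
  ((m%:R / 2)%:E <= expected_steps (@vpos R V) (@vadj R V E) s t)%E.
Proof.
move=> T mem [[n1 s1] [n2 s2] [n3 s3]] kk1 kk2 kk3 es et hm.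
have bd := half_pow_bounds R.
have e01 : 0 <= (1 / 2 : R) ^+ k <= 1 by case/andP: (bd k) => /ltW -> ->.
have [] := @potential_spoke 0 ltac:(lra); rewrite !comb2_id subr0 => pu1 pu2 pu3.
have [] := @potential_spoke 1 ltac:(lra); rewrite !comb2_id subrr => pm1 pm2 pm3.
have ps j : [/\ potential (spoke u1 m1 j) = 1 - (1 / 2) ^+ j,
    potential (spoke u2 m2 j) = 1 - (1 / 2) ^+ j &
    potential (spoke u3 m3 j) = 1 - (1 / 2) ^+ j].
  by apply: potential_spoke; case/andP: (bd j) => /ltW -> ->.
have pow_le i : (k <= i)%N -> (1 / 2 : R) ^+ i <= (1 / 2) ^+ k.
  move=> ki; have [k0 _] := andP e01; have [_ i1] := andP (bd (i - k)%N).
  by rewrite -(subnK ki) exprD ler_piMl.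
apply: (expected_steps_ge (phi := fun v => potential (vpos v)) (e := (1 / 2) ^+ k)) => //.
- by move=> v; apply: potential01.
- by rewrite es pu1.
- by rewrite et potential_hub.
move=> v vt.
(* At the [mi] the potential is already zero, so nothing about the routing there has to be known. *)
have zero : potential (vpos v) = 0 -> (1 - (1 / 2) ^+ k) * potential (vpos v) <=
    \sum_w rc_step (@vpos R V) (@vadj R V E) t v w * potential (vpos w).
  move=> ->; rewrite mulr0; apply: sumr_ge0 => w _; apply: mulr_ge0.
    exact: rc_step_ge0.
  by case/andP: (potential01 (vpos w)).
(* At an outer vertex whose arm has [i] points the loss is 2^-(i+1), within the allowed 2^-k. *)
have top i : (k <= i)%N ->
    (1 - (1 / 2) ^+ k) * 1 <= (1 + (1 - (1 / 2 : R) ^+ i)) / 2.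
  by move=> /pow_le; case/andP: e01; lra.
(* At a subdivision point the mean is preserved exactly; the factor on the left is slack. *)
have mid j : (1 - (1 / 2) ^+ k) * (1 - (1 / 2) ^+ j.+1) <=
    (1 + (1 - (1 / 2 : R) ^+ j)) / 2.
  have -> : (1 + (1 - (1 / 2 : R) ^+ j)) / 2 = 1 - (1 / 2) ^+ j.+1.
    by rewrite exprS; field.
  by rewrite ler_piMl//; case/andP: e01; case/andP: (bd j.+1); lra.
have [p1 p2 p3] : [/\ forall j, potential (spoke u1 m1 j) = 1 - (1 / 2) ^+ j,
    forall j, potential (spoke u2 m2 j) = 1 - (1 / 2) ^+ j &
    forall j, potential (spoke u3 m3 j) = 1 - (1 / 2) ^+ j].
  by split=> j; case: (ps j).
case: (mem _ (vpos_mem v)) => [|[] [j jk ev]].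
- rewrite !inE => /or4P[/eqP ev|/eqP ev|/eqP ev|/or4P[] /eqP ev].
  + by case/eqP: vt; apply: (vpos_inj (tri_uniq T)); rewrite et.
  + by apply: zero; rewrite ev.
  + by apply: zero; rewrite ev.
  + by apply: zero; rewrite ev.
  + by apply: (next_step T et (a := u2) (b := spoke u1 m1 k1)); rewrite ev// pu1 pu2 p1 top.
  + by apply: (next_step T et (a := u3) (b := spoke u2 m2 k2)); rewrite ev// pu2 pu3 p2 top.
  + by apply: (next_step T et (a := u1) (b := spoke u3 m3 k3)); rewrite ev// pu3 pu1 p3 top.
- by apply: (next_step T et (a := u2) (b := spoke u1 m1 j)); rewrite ev ?pu2 ?p1//; exact: s1.
- by apply: (next_step T et (a := u3) (b := spoke u2 m2 j)); rewrite ev ?pu3 ?p2//; exact: s2.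
- by apply: (next_step T et (a := u1) (b := spoke u3 m3 j)); rewrite ev ?pu1 ?p3//; exact: s3.
Qed.
End Pinwheel.

Theorem theorem1 (R : realType) :
  exists c : R, 0 < c /\
  exists N : nat, forall n : nat, (N <= n)%N ->
    exists (pos : 'I_n -> (R * R)%type) (adj : rel 'I_n) (s t : 'I_n),
      is_triangulation pos adj /\
      (((2 : R) `^ (c * n%:R))%:E <= expected_steps pos adj s t)%E.
Proof.
(* The bound reached is 2^(k - 2) with n <= 3k + 9, hence at least 2^(n/3 - 5), and n/3 - 5 >= n/6
   from n = 30 on. *)
exists (1 / 6); split; first by lra.
(* Seven vertices form the pinwheel; the other n - 7 go to arms of [k], [k] and [l] points, the last
   one taking the remainder. *)
exists 30%N => n hn; pose k := ((n - 7) %/ 3)%N; pose l := (n - 7 - k - k)%N.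
have kl : (k <= l)%N by rewrite /l /k; lia.
have [V [E [T sz sub mem fans]]] := pinwheel_fans R k k l.
have en : n = size V by rewrite sz /l /k; lia.
have [s es] : exists s : 'I_(size V), vpos s = u1 R.
  by apply: vpos_surj; apply: sub; rewrite !inE eqxx ?orbT.
have [t et] : exists t : 'I_(size V), vpos t = hub R.
  by apply: vpos_surj; apply: sub; rewrite !inE eqxx ?orbT.
have hk : (n <= 3 * k + 9)%N by rewrite /k; lia.
move: hn hk; rewrite en => hn hk; exists (@vpos R V), (@vadj R V E), s, t.
split; first exact: triangulated_is_triangulation T.
have k2 : (2 <= k)%N by lia.
have e2 : (2 : R) ^+ k = 4 * 2 ^+ (k - 2) by rewrite -{1}(subnK k2) addn2 !exprS; ring.
have p2 : 0 < (2 : R) ^+ (k - 2) by rewrite exprn_gt0.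
have eh : (1 / 2 : R) ^+ k = (4 * 2 ^+ (k - 2))^-1 by rewrite div1r exprVn e2.
(* The number of steps is 2^(k - 1), the largest whose product with 2^-k is at most 1/2; half of it
   is the final bound. *)
have hm : (2 * 2 ^ (k - 2))%N%:R * (1 / 2 : R) ^+ k <= 1 / 2.
  rewrite eh natrM natrX; move: p2; move: (2 ^+ (k - 2)) => r r0.
  by have -> : 2 * r * (4 * r)^-1 = 1 / 2 by field; rewrite gt_eqF.
have := pinwheel_steps T mem fans (leqnn k) (leqnn k) kl es et hm.
apply: le_trans; rewrite lee_fin.
have -> : (2 * 2 ^ (k - 2))%N%:R / 2 = (2 : R) `^ (k - 2)%N%:R.
  by rewrite powR_mulrn// natrM natrX; field.
apply: ler_powR; first by rewrite ler1n.
rewrite natrB//; have : (size V)%:R <= (3 * k + 9)%N%:R :> R by rewrite ler_nat.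
have : 30 <= (size V)%:R :> R by rewrite ler_nat.
rewrite natrD natrM; lra.
Qed.
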